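(* Let $\mathbb{T}$ be a time scale, $a,b\in\mathbb{T}$, $\mathbb{T}_\ast=[a,b]_{\mathbb{T}}$. Let $u(t)$ and $f(t)$ be nonnegative rd-continuous functions on $\mathbb{T}_\ast$ and $\mathbb{T}_\ast^\kappa$, respectively. Let $k(t,s)$ be a kernel satisfying condition (K) of the context, such that $k(t,s)$ and $k^{\Delta_1}(t,s)$ are nonnegative for every $t,s\in\mathbb{T}_\ast$ with $s\le t$ for which they are defined, and $k$ is not identically zero on $\mathbb{T}_\ast^\kappa\times\mathbb{T}_\ast^{\kappa^2}$. Let $\Phi\in C(\mathbb{R}^+_0,\mathbb{R}^+_0)$ be nondecreasing, subadditive and submultiplicative with $\Phi(x)>0$ for $x>0$, and let $W\in C(\mathbb{R}^+_0,\mathbb{R}^+_0)$ be nondecreasing with $W(x)>0$ for $x>0$. Let $a(t)$ be a positive, rd-continuous and nondecreasing function on $\mathbb{T}_\ast$. If $$u(t)\le a(t)+\int_a^tf(s)u(s)\Delta s+\int_a^tf(s)W\left(\int_a^sk(s,\tau)\Phi(u(\tau))\Delta\tau\right)\Delta s$$ for $a\le\tau\le s\le t\le b$, $\tau,s,t\in\mathbb{T}_\ast$, then for all $t\in\mathbb{T}_\ast$ satisfying $$\Psi(\zeta)+\int_a^{\rho(t)}k(\rho(t),s)\Phi(p(s))\Phi\left(\int_a^sf(\tau)\Delta\tau\right)\Delta s\in\operatorname{Dom}(\Psi^{-1})$$ we have $$u(t)\le p(t)a(t)+p(t)\int_a^tf(s)W\left[\Psi^{-1}\left(\Psi(\zeta)+\int_a^sk(s,\tau)\Phi(p(\tau))\Phi\left(\int_a^\tau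 f(\theta)\Delta\theta\right)\Delta\tau\right)\right]\Delta s,$$ where $$p(t)=1+\int_a^tf(s)e_f(t,\sigma(s))\Delta s,\qquad \zeta=\int_a^{\rho(b)}k(\rho(b),s)\Phi(p(s)a(s))\Delta s,$$ $$\Psi(x)=\int_{x_0}^x\frac{1}{\Phi(W(s))}ds,\quad x>0,\ x_0>0,$$ and $\Psi^{-1}$ is the inverse of $\Psi$.
   Context: $\mathbb{R}^+_0=[0,\infty)$. A time scale is a nonempty closed subset of $\mathbb{R}$; $[a,b]_{\mathbb{T}}=[a,b]\cap\mathbb{T}$; $\sigma(t)=\inf\{s\in\mathbb{T}:s>t\}$, $\rho(t)=\sup\{s\in\mathbb{T}:s<t\}$, $\mu(t)=\sigma(t)-t$. A superscript $\kappa$ removes the maximum if it is left-scattered ($\rho(t)<t$); $\kappa^2$ means twice. $f^\Delta$ is the $\Delta$-derivative (for each $\varepsilon>0$, $|f(\sigma(t))-f(s)-f^\Delta(t)(\sigma(t)-s)|\le\varepsilon|\sigma(t)-s|$ near $t$). rd-continuous: continuous at right-dense points ($\sigma(t)=t$), with finite left limits at left-dense points ($\rho(t)=t$). $\int_c^d f\Delta t=F(d)-F(c)$ with $F^\Delta=f$. For rd-continuous $q$ with $1+\mu(t)q(t)\ne0$ for all $t$, $e_q(\cdot,t_0)$ is the unique solution of $y^\Delta=q(t)y$, $y(t_0)=1$. The symbol $a(t)$ (a function) is distinct from the endpoint $a$. Condition (K): $k$ is a real function of two time-scale variables such that for each $t\in\mathbb{T}_\ast^\kappa$ with $t>a$: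 $k$ is continuous at $(t,t)$; $k(t,\cdot)$ is rd-continuous on $[a,\sigma(t)]$; and for each $\varepsilon>0$ there is a neighborhood $U$ of $t$, independent of $\tau\in[a,\sigma(t)]$, with $|k(\sigma(t),\tau)-k(s,\tau)-k^{\Delta_1}(t,\tau)(\sigma(t)-s)|\le\varepsilon|\sigma(t)-s|$ for all $s\in U$, where $k^{\Delta_1}$ is the $\Delta$-derivative of $k$ with respect to the first variable. *)

(* Defs.v *)
From Stdlib Require Import Reals ClassicalEpsilon.
From Coquelicot Require Import Coquelicot.
Open Scope R_scope.

(* Subsets of the line, in particular time scales, are predicates on R, and a
   function on a subset is a function on R of which only the values on that
   subset are ever used. *)

Definition time_scale (T : R -> Prop) : Prop := (exists t, T t) /\ closed T.

Definition ts_itv (T : R -> Prop) (c d : R) : R -> Prop :=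
  fun t => T t /\ c <= t <= d.

(* The greatest lower bound of the empty set is [p_infty] and the least upper
   bound of the empty set is [m_infty]; the fallback value implements the usual
   conventions inf {} = sup T and sup {} = inf T. *)
Definition fjump (T : R -> Prop) (t : R) : R :=
  match Glb_Rbar (fun s => T s /\ t < s) with Finite x => x | _ => t end.

Definition bjump (T : R -> Prop) (t : R) : R :=
  match Lub_Rbar (fun s => T s /\ s < t) with Finite x => x | _ => t end.

Definition kappa (T : R -> Prop) : R -> Prop :=
  fun t => T t /\ ~ ((forall s, T s -> s <= t) /\ bjump T t < t).

Definition is_delta_derive (T : R -> Prop) (g : R -> R) (t l : R) : Prop :=
  kappa T t /\
  forall eps : posreal, locally t (fun s => T s ->
    Rabs (g (fjump T t) - g s - l * (fjump T t - s))
      <= eps * Rabs (fjump T t - s)).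

(* At a point of [kappa T] the derivative is unique, except when T has a single
   point: there every number satisfies the defining condition, so that no
   derivative is defined. *)
Definition ex_delta_derive (T : R -> Prop) (g : R -> R) (t : R) : Prop :=
  exists! l, is_delta_derive T g t l.

Definition delta_derive (T : R -> Prop) (g : R -> R) (t : R) : R :=
  epsilon (inhabits 0) (is_delta_derive T g t).

(* rd-continuity on D of a function on D; right-dense and left-dense refer to
   the ambient time scale T. *)
Definition rd_continuous (T D : R -> Prop) (g : R -> R) : Prop :=
  forall t, D t ->
    (fjump T t = t -> filterlim g (within D (locally t)) (locally (g t))) /\
    (bjump T t = t -> exists l : R,
       filterlim g (within (fun s => D s /\ s < t) (locally t)) (locally l)).

(* The antiderivative G is only required between c and d, because an integrand
   such as k(s, .) need not be rd-continuous beyond the range of integration. *)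
Definition is_delta_int (T : R -> Prop) (g : R -> R) (c d I : R) : Prop :=
  exists G : R -> R,
    (forall t, kappa T t -> Rmin c d <= t <= Rmax c d ->
       is_delta_derive T G t (g t)) /\
    I = G d - G c.

Definition delta_int (T : R -> Prop) (g : R -> R) (c d : R) : R :=
  epsilon (inhabits 0) (is_delta_int T g c d).

Definition is_delta_exp (T : R -> Prop) (q : R -> R) (t0 : R) (y : R -> R)
    : Prop :=
  y t0 = 1 /\ forall t, kappa T t -> is_delta_derive T y t (q t * y t).

(* [delta_exp T q t t0] is e_q(t, t0). *)
Definition delta_exp (T : R -> Prop) (q : R -> R) (t t0 : R) : R :=
  epsilon (inhabits (fun _ => 0)) (is_delta_exp T q t0) t.

(* Here T is the compact time scale whose left endpoint is a. *)
Definition kernel_cond (T : R -> Prop) (a : R) (k : R -> R -> R) : Prop :=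
  forall t, kappa T t -> a < t ->
    filterlim (fun z : R * R => k (fst z) (snd z))
      (within (fun z : R * R => T (fst z) /\ T (snd z)) (locally (t, t)))
      (locally (k t t)) /\
    rd_continuous T (ts_itv T a (fjump T t)) (k t) /\
    (forall tau, ts_itv T a (fjump T t) tau ->
       ex_delta_derive T (fun x => k x tau) t) /\
    (forall eps : posreal, locally t (fun s => T s ->
       forall tau, ts_itv T a (fjump T t) tau ->
         Rabs (k (fjump T t) tau - k s tau
               - delta_derive T (fun x => k x tau) t * (fjump T t - s))
           <= eps * Rabs (fjump T t - s))).

Definition continuous_Rplus (g : R -> R) : Prop :=
  forall x, 0 <= x ->
    filterlim g (within (fun y => 0 <= y) (locally x)) (locally (g x)).

Definition nondecreasing_on (D : R -> Prop) (g : R -> R) : Prop :=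
  forall x y, D x -> D y -> x <= y -> g x <= g y.

Definition Psi (Phi W : R -> R) (x0 x : R) : R :=
  RInt (fun s => / Phi (W s)) x0 x.

(* The domain of [Psi] is the set of positive reals. *)
Definition Dom_Psi_inv (Phi W : R -> R) (x0 y : R) : Prop :=
  exists x, 0 < x /\ Psi Phi W x0 x = y.

Definition Psi_inv (Phi W : R -> R) (x0 y : R) : R :=
  epsilon (inhabits 0) (fun x => 0 < x /\ Psi Phi W x0 x = y).

(* Main.v *)
Require Import Defs.
From Stdlib Require Import Reals Lra ClassicalEpsilon Ranalysis5.
From Stdlib Require Import FunctionalExtensionality PropExtensionality.
From Coquelicot Require Import Coquelicot.
Open Scope R_scope.

(** The function [p] is the exponential function of [f] started at [a], because
    the integral that defines it telescopes ([delta_int_exp]).  Let [v t] be the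
    term with [W] in the hypothesis on [u], and [X s] the argument of [W] in it.
    As [alpha + v] is nondecreasing, Gronwall's inequality ([delta_gronwall])
    gives [u <= p * (alpha + v)], and what remains is [X <= Psi_inv \o H] at
    all points up to [bjump T t].

    Since [X] is nondecreasing, [v s <= W (X s) * F s] with [F] the integral of
    [f]; subadditivity and submultiplicativity of [Phi] then give
    [Phi (u s) <= Phi (p s * alpha s) + Phi (p s) * Phi (F s) * Phi (W (X s))].
    Integrated against the kernel, the first term contributes at most [zeta].
    Because [k] is nondecreasing in its first argument, for [s <= t] the second
    one is at most the integral up to [s] with the kernel frozen at [k t].  So
    Bihari's inequality ([delta_bihari]) applies with a fixed integrand and
    yields [Psi Y <= H t] for a bound [Y] of [X t]; the integrals that depend
    on their end point through [k] never have to be differentiated.  If [zeta = 0], then [X]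
    vanishes and only [0 < Psi_inv (H s)] is used.

    All this presupposes that the integrals exist.  An rd-continuous function
    has an antiderivative: the Riemann integral of its extension that is
    constant on the gaps of the scale ([delta_antideriv_exists]).  That [X] and
    [H] are rd-continuous is a matter of right-dense points only, as they are
    monotone; there the uniform differentiability of the kernel makes it
    Lipschitz in the first argument, at least for second arguments away from
    the diagonal, and the rest of the integral is small
    ([kernel_int_continuous]).  Inequalities between integrals come from the
    mean value inequality ([delta_derive_nonneg_incr]), proved by induction
    along the scale ([scale_ind]). *)

(** * Limits within a set *)

Lemma filterlim_withinP (D : R -> Prop) (g : R -> R) (t l : R) :
  filterlim g (within D (locally t)) (locally l) <->
  forall eps, 0 < eps -> exists delta, 0 < delta /\
    forall s, D s -> Rabs (s - t) < delta -> Rabs (g s - l) < eps.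
Proof.
rewrite filterlim_locally; split.
- intros H eps He; destruct (H (mkposreal eps He)) as [d Hd].
  exists d; split; [apply cond_pos|]; intros s Ds Hs; exact (Hd s Hs Ds).
- intros H eps; destruct (H eps (cond_pos eps)) as [d [d0 Hd]].
  exists (mkposreal d d0); intros s Hs Ds; exact (Hd s Ds Hs).
Qed.

Lemma locally_Rabs (t : R) (P : R -> Prop) :
  locally t P <->
  exists delta, 0 < delta /\ forall s, Rabs (s - t) < delta -> P s.
Proof.
split.
- intros [d Hd]; exists d; split; [apply cond_pos|]; exact Hd.
- intros [d [d0 Hd]]; exists (mkposreal d d0); exact Hd.
Qed.

Lemma filterlim_within_subset (D D' : R -> Prop) (g : R -> R) (t l : R) :
  (forall s, D' s -> D s) ->
  filterlim g (within D (locally t)) (locally l) ->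
  filterlim g (within D' (locally t)) (locally l).
Proof.
intros HD; rewrite !filterlim_withinP; intros H eps He.
destruct (H eps He) as [d [d0 Hd]]; exists d; split; auto.
Qed.

Lemma filterlim_within_mult (D : R -> Prop) (g h : R -> R) (t l m : R) :
  filterlim g (within D (locally t)) (locally l) ->
  filterlim h (within D (locally t)) (locally m) ->
  filterlim (fun s => g s * h s) (within D (locally t)) (locally (l * m)).
Proof.
intros Hg Hh; eapply filterlim_comp_2; [exact Hg|exact Hh|].
exact (@filterlim_mult R_AbsRing l m).
Qed.

Lemma filterlim_within_plus (D : R -> Prop) (g h : R -> R) (t l m : R) :
  filterlim g (within D (locally t)) (locally l) ->
  filterlim h (within D (locally t)) (locally m) ->
  filterlim (fun s => g s + h s) (within D (locally t)) (locally (l + m)).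
Proof.
intros Hg Hh; eapply filterlim_comp_2; [exact Hg|exact Hh|].
exact (@filterlim_plus R_AbsRing R_NormedModule l m).
Qed.

Lemma filterlim_within_ext_in (D : R -> Prop) (g h : R -> R) (t l : R) :
  (forall s, D s -> g s = h s) ->
  filterlim g (within D (locally t)) (locally l) ->
  filterlim h (within D (locally t)) (locally l).
Proof.
intros E; rewrite !filterlim_withinP; intros H eps He.
destruct (H eps He) as [d [d0 Hd]]; exists d; split; [exact d0|].
intros s Ds Hs; rewrite <- (E s Ds); auto.
Qed.

Lemma filterlim_within_const (D : R -> Prop) (t c : R) :
  filterlim (fun _ => c) (within D (locally t)) (locally c).
Proof.
apply filterlim_withinP; intros eps He; exists 1; split; [lra|].
intros; rewrite Rminus_diag, Rabs_R0; exact He.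
Qed.

Lemma filterlim_within_comp (D : R -> Prop) (phi G : R -> R) (t : R) :
  continuous phi (G t) ->
  filterlim G (within D (locally t)) (locally (G t)) ->
  filterlim (fun s => phi (G s)) (within D (locally t)) (locally (phi (G t))).
Proof. intros Hphi HG; exact (filterlim_comp _ _ _ _ _ _ _ _ HG Hphi). Qed.

Section Scale.

Context (T : R -> Prop) (a b : R).
Context (T_closed : closed T) (Ta : T a) (Tb : T b).
Context (T_bounds : forall t, T t -> a <= t <= b).

(** * The jump operators and induction along a scale *)

Lemma closed_inf (A : R -> Prop) (m : R) :
  (forall s, A s -> T s) -> (exists s, A s) -> (forall s, A s -> m <= s) ->
  exists x, Glb_Rbar A = Finite x /\ T x /\ m <= x /\
    (forall s, A s -> x <= s) /\ (forall e, x < e -> exists s, A s /\ s < e).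
Proof.
intros AT [s0 As0] Am.
destruct (Glb_Rbar_correct A) as [Hlb Hglb].
destruct (Glb_Rbar A) as [x| |].
- assert (Happ : forall e, x < e -> exists s, A s /\ s < e).
  { intros e He; apply NNPP; intros Hn.
    assert (He' : Rbar_le e x).
    { apply Hglb; intros s As; simpl; apply Rnot_lt_le; intros Hs.
      apply Hn; exists s; split; assumption. }
    simpl in He'; lra. }
  exists x; split; [reflexivity|]; split; [|split; [|split]].
  + apply T_closed; intros [d Hd].
    destruct (Happ (x + d)) as [s [As Hs]]; [pose proof (cond_pos d); lra|].
    pose proof (Hlb s As) as Hxs; simpl in Hxs.
    apply (Hd s); [|exact (AT s As)].
    change (Rabs (s - x) < d); rewrite Rabs_pos_eq; lra.
  + exact (Hglb m Am).
  + exact Hlb.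
  + exact Happ.
- exfalso; exact (Hlb s0 As0).
- exfalso; exact (Hglb m Am).
Qed.

Lemma closed_sup (A : R -> Prop) (m : R) :
  (forall s, A s -> T s) -> (exists s, A s) -> (forall s, A s -> s <= m) ->
  exists x, Lub_Rbar A = Finite x /\ T x /\ x <= m /\
    (forall s, A s -> s <= x) /\ (forall e, e < x -> exists s, A s /\ e < s).
Proof.
intros AT [s0 As0] Am.
destruct (Lub_Rbar_correct A) as [Hub Hlub].
destruct (Lub_Rbar A) as [x| |].
- assert (Happ : forall e, e < x -> exists s, A s /\ e < s).
  { intros e He; apply NNPP; intros Hn.
    assert (He' : Rbar_le x e).
    { apply Hlub; intros s As; simpl; apply Rnot_lt_le; intros Hs.
      apply Hn; exists s; split; assumption. }
    simpl in He'; lra. }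
  exists x; split; [reflexivity|]; split; [|split; [|split]].
  + apply T_closed; intros [d Hd].
    destruct (Happ (x - d)) as [s [As Hs]]; [pose proof (cond_pos d); lra|].
    pose proof (Hub s As) as Hxs; simpl in Hxs.
    apply (Hd s); [|exact (AT s As)].
    change (Rabs (s - x) < d); rewrite Rabs_left1; lra.
  + exact (Hlub m Am).
  + exact Hub.
  + exact Happ.
- exfalso; exact (Hlub m Am).
- exfalso; exact (Hub s0 As0).
Qed.

Lemma fjump_spec (t : R) : T t -> t < b ->
  T (fjump T t) /\ t <= fjump T t /\
  (forall s, T s -> t < s -> fjump T t <= s) /\
  (forall e, fjump T t < e -> exists s, T s /\ t < s < e).
Proof.
intros Tt tb.
destruct (closed_inf (fun s => T s /\ t < s) t) as [x [Ex [Tx [tx [Hlb Happ]]]]].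
- tauto.
- exists b; split; assumption.
- intros s [_ Hs]; lra.
- unfold fjump; rewrite Ex; split; [exact Tx|split; [exact tx|split]].
  + intros s Ts Hs; apply Hlb; split; assumption.
  + intros e He; destruct (Happ e He) as [s [[Ts Hs] Hse]].
    exists s; repeat split; assumption.
Qed.

Lemma bjump_spec (t : R) : T t -> a < t ->
  T (bjump T t) /\ bjump T t <= t /\
  (forall s, T s -> s < t -> s <= bjump T t) /\
  (forall e, e < bjump T t -> exists s, T s /\ e < s < t).
Proof.
intros Tt at'.
destruct (closed_sup (fun s => T s /\ s < t) t) as [x [Ex [Tx [tx [Hlb Happ]]]]].
- tauto.
- exists a; split; assumption.
- intros s [_ Hs]; lra.
- unfold bjump; rewrite Ex; split; [exact Tx|split; [exact tx|split]].
  + intros s Ts Hs; apply Hlb; split; assumption.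
  + intros e He; destruct (Happ e He) as [s [[Ts Hs] Hse]].
    exists s; repeat split; assumption.
Qed.

Lemma fjump_max : fjump T b = b.
Proof.
unfold fjump; destruct (Glb_Rbar_correct (fun s => T s /\ b < s)) as [_ Hglb].
assert (H : Rbar_le p_infty (Glb_Rbar (fun s => T s /\ b < s))).
{ apply Hglb; intros s [Ts Hs]; pose proof (T_bounds s Ts); lra. }
destruct (Glb_Rbar (fun s => T s /\ b < s)); simpl in H; tauto.
Qed.

Lemma bjump_min : bjump T a = a.
Proof.
unfold bjump; destruct (Lub_Rbar_correct (fun s => T s /\ s < a)) as [_ Hlub].
assert (H : Rbar_le (Lub_Rbar (fun s => T s /\ s < a)) m_infty).
{ apply Hlub; intros s [Ts Hs]; pose proof (T_bounds s Ts); lra. }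
destruct (Lub_Rbar (fun s => T s /\ s < a)); simpl in H; tauto.
Qed.

Lemma T_fjump (t : R) : T t -> T (fjump T t).
Proof.
intros Tt; destruct (Rlt_le_dec t b) as [tb|tb].
- apply fjump_spec; assumption.
- pose proof (T_bounds t Tt); replace t with b by lra; rewrite fjump_max; exact Tb.
Qed.

Lemma fjump_ge (t : R) : T t -> t <= fjump T t.
Proof.
intros Tt; destruct (Rlt_le_dec t b) as [tb|tb].
- apply fjump_spec; assumption.
- pose proof (T_bounds t Tt); replace t with b by lra; rewrite fjump_max; lra.
Qed.

Lemma fjump_le (t s : R) : T t -> T s -> t < s -> fjump T t <= s.
Proof.
intros Tt Ts ts; pose proof (T_bounds s Ts).
apply fjump_spec; auto; lra.
Qed.

Lemma T_bjump (t : R) : T t -> T (bjump T t).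
Proof.
intros Tt; destruct (Rlt_le_dec a t) as [tb|tb].
- apply bjump_spec; assumption.
- pose proof (T_bounds t Tt); replace t with a by lra; rewrite bjump_min; exact Ta.
Qed.

Lemma bjump_le (t : R) : T t -> bjump T t <= t.
Proof.
intros Tt; destruct (Rlt_le_dec a t) as [tb|tb].
- apply bjump_spec; assumption.
- pose proof (T_bounds t Tt); replace t with a by lra; rewrite bjump_min; lra.
Qed.

Lemma bjump_ge (t s : R) : T t -> T s -> s < t -> s <= bjump T t.
Proof.
intros Tt Ts ts; pose proof (T_bounds s Ts).
apply bjump_spec; auto; lra.
Qed.

Lemma bjump_mono (s t : R) : T s -> T t -> s <= t -> bjump T s <= bjump T t.
Proof.
intros Ts Tt [st| ->]; [|lra].
apply Rle_trans with s; [apply bjump_le; assumption|apply bjump_ge; assumption].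
Qed.

Lemma right_dense_approx (t delta : R) : T t -> t < b -> fjump T t = t ->
  0 < delta -> exists s, T s /\ t < s < t + delta.
Proof.
intros Tt tb Ht Hd; apply fjump_spec; auto; lra.
Qed.

Lemma left_dense_approx (t delta : R) : T t -> a < t -> bjump T t = t ->
  0 < delta -> exists s, T s /\ t - delta < s < t.
Proof.
intros Tt at' Ht Hd; apply bjump_spec; auto; lra.
Qed.

Lemma fjump_bjump (t : R) : T t -> bjump T t < t -> fjump T (bjump T t) = t.
Proof.
intros Tt Ht; pose proof (T_bjump t Tt) as Tr.
apply Rle_antisym; [apply fjump_le; assumption|].
apply Rnot_lt_le; intros Hlt.
pose proof (fjump_ge _ Tr) as [Hge|Heq].
- pose proof (bjump_ge t _ Tt (T_fjump _ Tr) Hlt); lra.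
- pose proof (T_bounds t Tt).
  destruct (right_dense_approx (bjump T t) (t - bjump T t)) as [s [Ts Hs]];
    auto; try lra.
  pose proof (bjump_ge t s Tt Ts); lra.
Qed.

Lemma kappaP (t : R) : kappa T t <-> T t /\ t <= bjump T b.
Proof.
unfold kappa; split.
- intros [Tt Hn]; split; [exact Tt|].
  pose proof (T_bounds t Tt) as [_ [tb|tb]].
  + apply bjump_ge; assumption.
  + subst t; apply Rnot_lt_le; intros Hlt; apply Hn; split; [|exact Hlt].
    intros s Ts; apply T_bounds; exact Ts.
- intros [Tt Ht]; split; [exact Tt|]; intros [Hmax Hlt].
  pose proof (Hmax b Tb); pose proof (T_bounds t Tt).
  replace t with b in * by lra; lra.
Qed.

Lemma kappa_T (t : R) : kappa T t -> T t.
Proof. intros [Tt _]; exact Tt. Qed.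

Lemma kappa_lt (t : R) : T t -> t < b -> kappa T t.
Proof. intros Tt tb; apply kappaP; split; [|apply bjump_ge]; assumption. Qed.

Lemma kappa_le (s t : R) : T s -> kappa T t -> s <= t -> kappa T s.
Proof. rewrite !kappaP; intros Ts [Tt Ht] st; split; [exact Ts|lra]. Qed.

(** Induction along a time scale: the infimum [m] of the points of [[c, d]]
    where [P] fails is a point of the scale.  If [P m] fails, one of the two
    ways of reaching [m] from the left is violated; if it holds, points where
    [P] fails accumulate at [m] from the right, so that [m] is right-dense. *)
Lemma scale_ind (P : R -> Prop) (c d : R) : T c -> P c ->
  (forall t, T t -> c <= t < d -> t < fjump T t -> P t -> P (fjump T t)) ->
  (forall t, T t -> c <= t < d -> t < b -> fjump T t = t -> P t ->
     exists delta, 0 < delta /\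
       forall s, T s -> t < s < t + delta -> s <= d -> P s) ->
  (forall t, T t -> c < t <= d -> bjump T t = t ->
     (forall s, T s -> c <= s < t -> P s) -> P t) ->
  forall t, T t -> c <= t <= d -> P t.
Proof.
intros Tc Pc Hrs Hrd Hld t Tt Ht; apply NNPP; intros Pt.
destruct (closed_inf (fun s => T s /\ c <= s <= d /\ ~ P s) c)
  as [m [_ [Tm [cm [Hlb Happ]]]]].
- tauto.
- exists t; tauto.
- intros s Hs; lra.
- assert (Pbefore : forall s, T s -> c <= s < m -> P s).
  { intros s Ts Hs; apply NNPP; intros Ps.
    assert (m <= s); [|lra].
    apply Hlb; split; [exact Ts|split; [|exact Ps]].
    pose proof (Hlb t (conj Tt (conj Ht Pt))); lra. }
  pose proof (Hlb t (conj Tt (conj Ht Pt))) as mt.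
  destruct (classic (P m)) as [Pm|Pm].
  + assert (md : m < t) by (destruct mt as [| <-]; [assumption|contradiction]).
    assert (mb : m < b) by (pose proof (T_bounds t Tt); lra).
    destruct (fjump_ge m Tm) as [mj|mj].
    * destruct (Happ (fjump T m) mj) as [s [[Ts [Hs Ps]] Hsj]].
      pose proof (Hlb s (conj Ts (conj Hs Ps))) as [ms|ms].
      -- pose proof (fjump_le m s Tm Ts ms); lra.
      -- subst s; contradiction.
    * destruct (Hrd m Tm ltac:(lra) mb (eq_sym mj) Pm) as [dl [dl0 Hdl]].
      destruct (Happ (m + dl) ltac:(lra)) as [s [[Ts [Hs Ps]] Hsj]].
      pose proof (Hlb s (conj Ts (conj Hs Ps))) as [ms|ms].
      -- apply Ps, Hdl; auto; lra.
      -- subst s; contradiction.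
  + assert (cm' : c < m) by (destruct cm as [| <-]; [assumption|contradiction]).
    destruct (bjump_le m Tm) as [jm|jm].
    * apply Pm; rewrite <- (fjump_bjump m Tm jm).
      pose proof (bjump_ge m c Tm Tc cm').
      apply Hrs; [apply T_bjump; exact Tm|lra|rewrite fjump_bjump; assumption|].
      apply Pbefore; [apply T_bjump; exact Tm|lra].
    * apply Pm, Hld; auto; lra.
Qed.

(** * Rd-continuous functions *)

Lemma rd_continuous_subset (D D' : R -> Prop) (g : R -> R) :
  (forall s, D' s -> D s) -> rd_continuous T D g -> rd_continuous T D' g.
Proof.
intros HD Hg t Dt; destruct (Hg t (HD t Dt)) as [Hr Hl]; split.
- intros Ht; apply filterlim_within_subset with D; auto.
- intros Ht; destruct (Hl Ht) as [l Hll]; exists l.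
  revert Hll; apply filterlim_within_subset; intros s [Ds Hs]; auto.
Qed.

Lemma rd_continuous_continuous (D : R -> Prop) (g : R -> R) :
  (forall t, D t -> filterlim g (within D (locally t)) (locally (g t))) ->
  rd_continuous T D g.
Proof.
intros Hg t Dt; split; intros _; [exact (Hg t Dt)|].
exists (g t); apply filterlim_within_subset with D; [tauto|exact (Hg t Dt)].
Qed.

Lemma rd_continuous_mult (D : R -> Prop) (g h : R -> R) :
  rd_continuous T D g -> rd_continuous T D h ->
  rd_continuous T D (fun s => g s * h s).
Proof.
intros Hg Hh t Dt; destruct (Hg t Dt) as [gr gl], (Hh t Dt) as [hr hl]; split.
- intros Ht; apply filterlim_within_mult; auto.
- intros Ht; destruct (gl Ht) as [l Hl], (hl Ht) as [m Hm].
  exists (l * m); apply filterlim_within_mult; assumption.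
Qed.

Lemma rd_continuous_comp (D : R -> Prop) (phi g : R -> R) :
  continuous_Rplus phi -> (forall s, D s -> 0 <= g s) ->
  rd_continuous T D g -> rd_continuous T D (fun s => phi (g s)).
Proof.
intros Hphi g0 Hg.
assert (Hcomp : forall (Q : R -> Prop) t l, (forall s, Q s -> D s) -> 0 <= l ->
  filterlim g (within Q (locally t)) (locally l) ->
  filterlim (fun s => phi (g s)) (within Q (locally t)) (locally (phi l))).
{ intros Q t l HQ l0 Hl; pose proof (Hphi l l0) as Hp.
  rewrite filterlim_withinP in Hp; rewrite filterlim_withinP in Hl.
  apply filterlim_withinP; intros eps He.
  destruct (Hp eps He) as [e1 [e10 He1]], (Hl e1 e10) as [d [d0 Hd]].
  exists d; split; [exact d0|]; intros s Qs Hs; apply He1; auto. }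
intros t Dt; destruct (Hg t Dt) as [gr gl]; split.
- intros Ht; apply Hcomp; auto.
- intros Ht; destruct (gl Ht) as [l Hl].
  (* The limit [l] may be negative, outside the domain of [phi], when no point
     lies to the left of [t]: then every number is a left limit. *)
  exists (phi (Rmax l 0)); apply Hcomp; [tauto|apply Rmax_r|].
  rewrite filterlim_withinP in Hl |- *; intros eps He.
  destruct (Hl eps He) as [d [d0 Hd]]; exists d; split; [exact d0|].
  intros s Qs Hs; pose proof (Hd s Qs Hs) as H1; pose proof (g0 s (proj1 Qs)).
  revert H1; unfold Rmax; destruct (Rle_dec l 0); [|tauto].
  unfold Rabs; repeat destruct Rcase_abs; lra.
Qed.

Lemma rd_continuous_bounded (g : R -> R) (d : R) :
  T d -> rd_continuous T (ts_itv T a d) g ->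
  exists M, 0 < M /\ forall s, T s -> a <= s <= d -> Rabs (g s) <= M.
Proof.
intros Td Hg; pose proof (T_bounds d Td) as Hd.
assert (H : forall t, T t -> a <= t <= d ->
  exists M, forall s, T s -> a <= s <= t -> Rabs (g s) <= M).
{ apply scale_ind; [exact Ta| | | |].
  - exists (Rabs (g a)); intros s Ts Hs; replace s with a by lra; lra.
  - intros t Tt Ht tj [M HM]; exists (Rmax M (Rabs (g (fjump T t)))).
    intros s Ts Hs; destruct (Rle_lt_dec s t) as [st|st].
    + apply Rle_trans with M; [apply HM; auto; lra|apply Rmax_l].
    + pose proof (fjump_le t s Tt Ts st).
      replace s with (fjump T t) by lra; apply Rmax_r.
  - intros t Tt Ht tb Htj [M HM].
    destruct (Hg t) as [Hr _]; [split; [exact Tt|lra]|].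
    specialize (Hr Htj); rewrite filterlim_withinP in Hr.
    destruct (Hr 1 Rlt_0_1) as [dl [dl0 Hdl]].
    exists dl; split; [exact dl0|]; intros s Ts Hs sd.
    exists (Rmax M (Rabs (g t) + 1)); intros r Tr Hrs.
    destruct (Rle_lt_dec r t) as [rt|rt].
    + apply Rle_trans with M; [apply HM; auto; lra|apply Rmax_l].
    + apply Rle_trans with (Rabs (g t) + 1); [|apply Rmax_r].
      assert (Hgr : Rabs (g r - g t) < 1).
      { apply Hdl; [split; [exact Tr|lra]|rewrite Rabs_pos_eq; lra]. }
      pose proof (Rabs_triang_inv (g r) (g t)); lra.
  - intros t Tt Ht Htj IH.
    destruct (Hg t) as [_ Hl]; [split; [exact Tt|lra]|].
    destruct (Hl Htj) as [l Hll]; rewrite filterlim_withinP in Hll.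
    destruct (Hll 1 Rlt_0_1) as [dl [dl0 Hdl]].
    destruct (left_dense_approx t (Rmin dl (t - a)) Tt) as [s [Ts Hs]];
      [lra|exact Htj|apply Rmin_pos; lra|].
    pose proof (Rmin_l dl (t - a)); pose proof (Rmin_r dl (t - a)).
    destruct (IH s Ts ltac:(lra)) as [M HM].
    exists (Rmax (Rmax M (Rabs l + 1)) (Rabs (g t))); intros r Tr Hr.
    destruct (Rle_lt_dec r s) as [rs|rs].
    { apply Rle_trans with M; [apply HM; auto; lra|].
      eapply Rle_trans; [apply Rmax_l|apply Rmax_l]. }
    destruct (Rlt_le_dec r t) as [rt|rt].
    + apply Rle_trans with (Rabs l + 1).
      * assert (Hgr : Rabs (g r - l) < 1).
        { apply Hdl; [repeat split; auto; lra|rewrite Rabs_left1; lra]. }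
        pose proof (Rabs_triang_inv (g r) l); lra.
      * eapply Rle_trans; [apply Rmax_r|apply Rmax_l].
    + replace r with t by lra; apply Rmax_r. }
destruct (H d Td ltac:(lra)) as [M HM]; exists (Rmax M 1); split.
- pose proof (Rmax_r M 1); lra.
- intros s Ts Hs; pose proof (Rmax_l M 1); pose proof (HM s Ts Hs); lra.
Qed.

(** When [t] is left-scattered, the scale has no point strictly between
    [bjump T t] and [t], and rd-continuity says nothing at the isolated end. *)
Lemma rd_continuous_extend (g : R -> R) (t : R) :
  T t -> rd_continuous T (ts_itv T a (bjump T t)) g ->
  rd_continuous T (ts_itv T a t) g.
Proof.
intros Tt Hg; destruct (bjump_le t Tt) as [jt|jt];
  [|rewrite jt in Hg; exact Hg].
intros s [Ts Hs]; destruct (Rlt_le_dec s t) as [st|st].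
- pose proof (bjump_ge t s Tt Ts st) as sj.
  destruct (Hg s) as [Hr Hl]; [split; [exact Ts|lra]|]; split.
  + intros Hsj; specialize (Hr Hsj); rewrite filterlim_withinP in Hr |- *.
    intros eps He; destruct (Hr eps He) as [d [d0 Hd]].
    exists (Rmin d (t - s)); split; [apply Rmin_pos; lra|].
    intros r [Tr Hr1] Hrs; apply Hd.
    * assert (rt : r < t).
      { pose proof (Rmin_r d (t - s)); pose proof (Rle_abs (r - s)); lra. }
      pose proof (bjump_ge t r Tt Tr rt); split; [exact Tr|lra].
    * pose proof (Rmin_l d (t - s)); lra.
  + intros Hsj; destruct (Hl Hsj) as [l Hll]; exists l.
    revert Hll; apply filterlim_within_subset.
    intros r [[Tr Hr1] rs]; repeat split; auto; lra.
- replace s with t by lra; split; [|intros; lra].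
  intros _; apply filterlim_withinP; intros eps He.
  exists (t - bjump T t); split; [lra|]; intros r [Tr Hr] Hrt.
  replace r with t; [rewrite Rminus_diag, Rabs_R0; exact He|].
  apply Rle_antisym; [|lra]; apply Rnot_lt_le; intros rt.
  pose proof (bjump_ge t r Tt Tr rt); rewrite Rabs_left1 in Hrt; lra.
Qed.

Lemma rd_continuous_kappa (g : R -> R) (d : R) :
  T d -> rd_continuous T (kappa T) g -> rd_continuous T (ts_itv T a d) g.
Proof.
intros Td Hg; apply rd_continuous_subset with (ts_itv T a b).
- intros s [Ts Hs]; split; [exact Ts|apply T_bounds; exact Ts].
- apply rd_continuous_extend; [exact Tb|].
  revert Hg; apply rd_continuous_subset; intros s [Ts Hs].
  apply kappaP; split; [exact Ts|apply Hs].
Qed.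

Lemma rd_continuous_plus (D : R -> Prop) (g h : R -> R) :
  rd_continuous T D g -> rd_continuous T D h ->
  rd_continuous T D (fun s => g s + h s).
Proof.
intros Hg Hh t Dt; destruct (Hg t Dt) as [gr gl], (Hh t Dt) as [hr hl]; split.
- intros Ht; apply filterlim_within_plus; auto.
- intros Ht; destruct (gl Ht) as [l Hl], (hl Ht) as [m Hm].
  exists (l + m); apply filterlim_within_plus; assumption.
Qed.

(** Monotonicity supplies the left limits. *)
Lemma rd_continuous_mono (D : R -> Prop) (G : R -> R) :
  (forall s t, D s -> D t -> s <= t -> G s <= G t) ->
  (forall t, D t -> fjump T t = t ->
     filterlim G (within D (locally t)) (locally (G t))) ->
  rd_continuous T D G.
Proof.
intros Gmono Gr t Dt; split; [exact (Gr t Dt)|]; intros _.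
destruct (classic (exists s, D s /\ s < t)) as [[s0 [Ds0 st0]]|Hno].
- destruct (completeness (fun y => exists s, D s /\ s < t /\ y = G s))
    as [l [Hub Hlub]].
  + exists (G t); intros y [s [Ds [st ->]]]; apply Gmono; auto; lra.
  + exists (G s0), s0; auto.
  + exists l; apply filterlim_withinP; intros eps He.
    assert (Hs1 : exists s1, D s1 /\ s1 < t /\ l - eps < G s1).
    { apply NNPP; intros Hn.
      assert (l <= l - eps); [|lra].
      apply Hlub; intros y [s [Ds [st ->]]]; apply Rnot_lt_le; intros Hlt.
      apply Hn; exists s; auto. }
    destruct Hs1 as [s1 [Ds1 [st1 Hs1]]].
    exists (t - s1); split; [lra|]; intros s [Ds st] Hs.
    rewrite Rabs_left1 in Hs by lra.
    pose proof (Gmono s1 s Ds1 Ds ltac:(lra)).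
    assert (G s <= l) by (apply Hub; exists s; auto).
    rewrite Rabs_left1; lra.
- exists 0; apply filterlim_withinP; intros eps He.
  exists 1; split; [lra|]; intros s Hs; exfalso; apply Hno; exists s; exact Hs.
Qed.

Lemma rd_continuous_point (g : R -> R) : rd_continuous T (ts_itv T a a) g.
Proof.
apply rd_continuous_continuous; intros t [_ Ht].
apply filterlim_within_ext_in with (fun _ => g t);
  [|apply filterlim_within_const].
intros s [_ Hs]; f_equal; lra.
Qed.

Lemma rd_continuous_itv_le (h : R -> R) (c d : R) : c <= d ->
  rd_continuous T (ts_itv T a d) h -> rd_continuous T (ts_itv T a c) h.
Proof.
intros cd; apply rd_continuous_subset; intros s [Ts Hs].
split; [exact Ts|lra].
Qed.

Lemma rd_continuous_on_kappa (g : R -> R) :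
  rd_continuous T T g -> rd_continuous T (kappa T) g.
Proof. apply rd_continuous_subset, kappa_T. Qed.

(** * Delta derivatives *)

Lemma delta_derive_step (G : R -> R) (t l : R) :
  T t -> is_delta_derive T G t l ->
  G (fjump T t) - G t = l * (fjump T t - t).
Proof.
intros Tt [_ H].
assert (mu0 := fjump_ge t Tt).
apply Rminus_diag_uniq, Rabs_eq_0, Rle_antisym; [|apply Rabs_pos].
apply le_epsilon; intros eps He; rewrite Rplus_0_l.
set (mu := fjump T t - t) in *.
assert (He' : 0 < eps / (mu + 1)) by (apply Rdiv_lt_0_compat; unfold mu; lra).
destruct (H (mkposreal _ He')) as [d Hd].
pose proof (Hd t (ball_center t d) Tt) as Ht; simpl in Ht; fold mu in Ht.
rewrite (Rabs_pos_eq mu) in Ht by (unfold mu; lra).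
apply Rle_trans with (1 := Ht).
apply Rmult_le_reg_r with (mu + 1); [unfold mu; lra|].
replace (eps / (mu + 1) * mu * (mu + 1)) with (eps * mu)
  by (field; unfold mu; lra).
apply Rmult_le_compat_l; lra.
Qed.

Lemma delta_derive_continuous (G : R -> R) (t l : R) :
  is_delta_derive T G t l ->
  filterlim G (within T (locally t)) (locally (G t)).
Proof.
intros HG; pose proof (kappa_T t (proj1 HG)) as Tt.
pose proof (delta_derive_step G t l Tt HG) as Hstep.
assert (mu0 := fjump_ge t Tt).
destruct HG as [_ HG].
set (mu := fjump T t - t) in *.
apply filterlim_withinP; intros eps He.
assert (He' : 0 < eps / (2 * (mu + 1))).
{ apply Rdiv_lt_0_compat; unfold mu; lra. }
destruct (proj1 (locally_Rabs _ _) (HG (mkposreal _ He'))) as [d [d0 Hd]].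
simpl in Hd; pose proof (Rabs_pos l) as l0.
assert (Hd2 : 0 < eps / (2 * (Rabs l + 1))) by (apply Rdiv_lt_0_compat; lra).
exists (Rmin (Rmin d 1) (eps / (2 * (Rabs l + 1)))).
split; [repeat apply Rmin_pos; lra|]; intros s Ts Hs.
pose proof (Rmin_l (Rmin d 1) (eps / (2 * (Rabs l + 1)))).
pose proof (Rmin_r (Rmin d 1) (eps / (2 * (Rabs l + 1)))).
pose proof (Rmin_l d 1); pose proof (Rmin_r d 1).
pose proof (Hd s ltac:(lra) Ts) as Hq.
assert (E : G s - G t =
  l * (s - t) - (G (fjump T t) - G s - l * (fjump T t - s))).
{ replace (G s) with (G (fjump T t) - (G (fjump T t) - G s)) at 1 by ring.
  replace (G (fjump T t)) with (G t + l * mu) at 1 by lra.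
  unfold mu; ring. }
rewrite E; eapply Rle_lt_trans; [apply Rabs_triang|].
rewrite Rabs_Ropp, Rabs_mult.
assert (B1 : Rabs l * Rabs (s - t) < eps / 2).
{ apply Rle_lt_trans with ((Rabs l + 1) * Rabs (s - t)).
  - apply Rmult_le_compat_r; [apply Rabs_pos|lra].
  - replace (eps / 2) with ((Rabs l + 1) * (eps / (2 * (Rabs l + 1))))
      by (field; lra).
    apply Rmult_lt_compat_l; lra. }
assert (B2 : Rabs (fjump T t - s) <= mu + 1).
{ replace (fjump T t - s) with (mu - (s - t)) by (unfold mu; ring).
  eapply Rle_trans; [apply Rabs_triang|].
  rewrite Rabs_Ropp, (Rabs_pos_eq mu); unfold mu; lra. }
assert (B3 : eps / (2 * (mu + 1)) * Rabs (fjump T t - s) <= eps / 2).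
{ apply Rle_trans with (eps / (2 * (mu + 1)) * (mu + 1)).
  - apply Rmult_le_compat_l; lra.
  - right; field; unfold mu; lra. }
lra.
Qed.

Lemma delta_derive_quotient (G : R -> R) (t l : R) : kappa T t ->
  is_delta_derive T G t l <->
  filterlim (fun s => (G (fjump T t) - G s) / (fjump T t - s))
    (within (fun s => T s /\ s <> fjump T t) (locally t)) (locally l).
Proof.
intros kt; rewrite filterlim_withinP; split.
- intros [_ H] eps He.
  pose proof (Rdiv_lt_0_compat _ 2 He Rlt_0_2) as He2.
  destruct (proj1 (locally_Rabs _ _) (H (mkposreal _ He2))) as [d [d0 Hd]].
  simpl in Hd; exists d; split; [exact d0|]; intros s [Ts Hs] Hst.
  specialize (Hd s Hst Ts).
  assert (Hn : fjump T t - s <> 0) by lra.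
  replace ((G (fjump T t) - G s) / (fjump T t - s) - l)
    with ((G (fjump T t) - G s - l * (fjump T t - s)) / (fjump T t - s))
    by (field; exact Hn).
  rewrite Rabs_div by exact Hn.
  pose proof (Rabs_pos_lt _ Hn).
  apply Rle_lt_trans with (eps / 2); [|lra].
  apply Rmult_le_reg_r with (Rabs (fjump T t - s)); [assumption|].
  unfold Rdiv at 1; rewrite Rmult_assoc, Rinv_l by lra; lra.
- intros H; split; [exact kt|]; intros eps.
  destruct (H eps (cond_pos eps)) as [d [d0 Hd]].
  apply locally_Rabs; exists d; split; [exact d0|]; intros s Hst Ts.
  destruct (Req_dec s (fjump T t)) as [->|Hs].
  + rewrite !Rminus_diag, Rmult_0_r, Rminus_0_r, Rabs_R0; lra.
  + specialize (Hd s (conj Ts Hs) Hst).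
    assert (Hn : fjump T t - s <> 0) by lra.
    replace (G (fjump T t) - G s - l * (fjump T t - s))
      with (((G (fjump T t) - G s) / (fjump T t - s) - l) * (fjump T t - s))
      by (field; exact Hn).
    rewrite Rabs_mult; apply Rmult_le_compat_r; [apply Rabs_pos|lra].
Qed.

Lemma delta_derive_ext (G K : R -> R) (t l : R) :
  (forall s, T s -> G s = K s) ->
  is_delta_derive T G t l -> is_delta_derive T K t l.
Proof.
intros E HG; pose proof (proj1 HG) as kt.
rewrite delta_derive_quotient in HG |- * by exact kt.
revert HG; apply filterlim_within_ext_in; intros s [Ts _].
rewrite !E; auto; apply T_fjump, kappa_T, kt.
Qed.

Lemma delta_derive_id (t : R) : kappa T t -> is_delta_derive T (fun s => s) t 1.
Proof.
intros kt; apply delta_derive_quotient; [exact kt|].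
apply filterlim_within_ext_in with (fun _ => 1);
  [|apply filterlim_within_const].
intros s [_ Hs]; field; lra.
Qed.

Lemma delta_derive_const (c t : R) :
  kappa T t -> is_delta_derive T (fun _ => c) t 0.
Proof.
intros kt; apply delta_derive_quotient; [exact kt|].
apply filterlim_within_ext_in with (fun _ => 0);
  [|apply filterlim_within_const].
intros s [_ Hs]; field; lra.
Qed.

Lemma delta_derive_plus (G K : R -> R) (t l m : R) :
  is_delta_derive T G t l -> is_delta_derive T K t m ->
  is_delta_derive T (fun s => G s + K s) t (l + m).
Proof.
intros HG HK; pose proof (proj1 HG) as kt.
rewrite delta_derive_quotient in HG, HK |- * by exact kt.
eapply filterlim_within_ext_in;
  [|exact (filterlim_within_plus _ _ _ _ _ _ HG HK)].
intros s [_ Hs]; simpl; field; lra.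
Qed.

Lemma delta_derive_scal (c : R) (G : R -> R) (t l : R) :
  is_delta_derive T G t l ->
  is_delta_derive T (fun s => c * G s) t (c * l).
Proof.
intros HG; pose proof (proj1 HG) as kt.
rewrite delta_derive_quotient in HG |- * by exact kt.
eapply filterlim_within_ext_in;
  [|exact (filterlim_within_mult _ _ _ _ _ _ (filterlim_within_const _ _ c) HG)].
intros s [_ Hs]; simpl; field; lra.
Qed.

Lemma delta_derive_minus (G K : R -> R) (t l m : R) :
  is_delta_derive T G t l -> is_delta_derive T K t m ->
  is_delta_derive T (fun s => G s - K s) t (l - m).
Proof.
intros HG HK.
replace (l - m) with (l + -1 * m) by ring.
apply delta_derive_ext with (fun s => G s + -1 * K s); [intros; ring|].
apply delta_derive_plus; [exact HG|apply delta_derive_scal; exact HK].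
Qed.

Lemma delta_derive_mult (G K : R -> R) (t l m : R) :
  is_delta_derive T G t l -> is_delta_derive T K t m ->
  is_delta_derive T (fun s => G s * K s) t (l * K (fjump T t) + G t * m).
Proof.
intros HG HK; pose proof (proj1 HG) as kt.
pose proof (delta_derive_continuous G t l HG) as Gc.
rewrite delta_derive_quotient in HG, HK |- * by exact kt.
apply filterlim_within_subset
  with (D' := fun s => T s /\ s <> fjump T t) in Gc; [|tauto].
eapply filterlim_within_ext_in; [|
  exact (filterlim_within_plus _ _ _ _ _ _
    (filterlim_within_mult _ _ _ _ _ _ HG
       (filterlim_within_const _ _ (K (fjump T t))))
    (filterlim_within_mult _ _ _ _ _ _ Gc HK))].
intros s [_ Hs]; simpl; field; lra.
Qed.

(** At a right-scattered point the quotients only have to converge to the one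
    over the gap, which is what continuity provides. *)
Lemma delta_derive_scattered (G : R -> R) (t : R) : T t -> t < fjump T t ->
  filterlim G (within T (locally t)) (locally (G t)) ->
  is_delta_derive T G t ((G (fjump T t) - G t) / (fjump T t - t)).
Proof.
intros Tt tj HG; set (l := (G (fjump T t) - G t) / (fjump T t - t)).
assert (tb : t < b) by (pose proof (T_bounds _ (T_fjump t Tt)); lra).
split; [apply kappa_lt; assumption|]; intros eps.
rewrite filterlim_withinP in HG.
set (mu := fjump T t - t) in *; assert (mu0 : 0 < mu) by (unfold mu; lra).
pose proof (cond_pos eps) as e0; pose proof (Rabs_pos l) as l0.
destruct (HG (eps * mu / 4)) as [d [d0 Hd]].
{ apply Rdiv_lt_0_compat; [apply Rmult_lt_0_compat|]; lra. }
assert (H4 : 0 < eps * mu / (4 * (Rabs l + 1))).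
{ apply Rdiv_lt_0_compat; [apply Rmult_lt_0_compat|]; lra. }
apply locally_Rabs.
exists (Rmin d (Rmin (mu / 2) (eps * mu / (4 * (Rabs l + 1))))).
split; [repeat apply Rmin_pos; lra|]; intros s Hs Ts.
pose proof (Rmin_l d (Rmin (mu / 2) (eps * mu / (4 * (Rabs l + 1))))).
pose proof (Rmin_r d (Rmin (mu / 2) (eps * mu / (4 * (Rabs l + 1))))).
pose proof (Rmin_l (mu / 2) (eps * mu / (4 * (Rabs l + 1)))).
pose proof (Rmin_r (mu / 2) (eps * mu / (4 * (Rabs l + 1)))).
pose proof (Hd s Ts ltac:(lra)) as Hq.
replace (G (fjump T t) - G s - l * (fjump T t - s))
  with (l * (s - t) - (G s - G t)) by (unfold l, mu; field; unfold mu in mu0; lra).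
apply Rle_trans with (eps * mu / 2).
- eapply Rle_trans; [apply Rabs_triang|]; rewrite Rabs_Ropp, Rabs_mult.
  assert (Rabs l * Rabs (s - t) <= eps * mu / 4); [|lra].
  apply Rle_trans with ((Rabs l + 1) * (eps * mu / (4 * (Rabs l + 1)))).
  + apply Rmult_le_compat; try apply Rabs_pos; lra.
  + right; field; lra.
- replace (eps * mu / 2) with (eps * (mu / 2)) by field.
  apply Rmult_le_compat_l; [lra|].
  replace (fjump T t - s) with (mu - (s - t)) by (unfold mu; ring).
  pose proof (Rle_abs (s - t)).
  rewrite Rabs_pos_eq; lra.
Qed.

(** The chain rule needs right-density: across a gap the increment of
    [phi \o G] is not governed by the derivative of [phi] at [G t]. *)
Lemma delta_derive_comp_dense (phi G : R -> R) (t l d : R) :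
  fjump T t = t -> is_delta_derive T G t l -> is_derive phi (G t) d ->
  is_delta_derive T (fun s => phi (G s)) t (d * l).
Proof.
intros Htj HG Hphi; pose proof (delta_derive_continuous G t l HG) as Gc.
destruct HG as [kt HG]; split; [exact kt|].
rewrite Htj in *; intros eps; pose proof (cond_pos eps) as e0.
pose proof (Rabs_pos l) as l0; pose proof (Rabs_pos d) as d0.
assert (e1 : 0 < eps / (2 * (Rabs l + 1))) by (apply Rdiv_lt_0_compat; lra).
assert (e2 : 0 < Rmin 1 (eps / (2 * (Rabs d + 1)))).
{ apply Rmin_pos; [lra|apply Rdiv_lt_0_compat; lra]. }
apply is_derive_Reals in Hphi.
destruct (Hphi _ e1) as [r Hr]; pose proof (cond_pos r) as r0.
rewrite filterlim_withinP in Gc; destruct (Gc r r0) as [d1 [d10 Hd1]].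
destruct (proj1 (locally_Rabs _ _) (HG (mkposreal _ e2))) as [d2 [d20 Hd2]].
simpl in Hd2.
apply locally_Rabs; exists (Rmin d1 d2); split; [apply Rmin_pos; lra|].
intros s Hs Ts; pose proof (Rmin_l d1 d2); pose proof (Rmin_r d1 d2).
specialize (Hd1 s Ts ltac:(lra)); specialize (Hd2 s ltac:(lra) Ts).
set (h := G s - G t) in *; set (u := Rabs (t - s)) in *.
assert (u0 : 0 <= u) by apply Rabs_pos.
pose proof (Rmin_l 1 (eps / (2 * (Rabs d + 1)))) as m1.
pose proof (Rmin_r 1 (eps / (2 * (Rabs d + 1)))) as m2.
set (m := Rmin 1 (eps / (2 * (Rabs d + 1)))) in *.
assert (Hh : Rabs h <= (Rabs l + 1) * u).
{ replace h with (- (G t - G s - l * (t - s)) + - (l * (t - s)))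
    by (unfold h; ring).
  eapply Rle_trans; [apply Rabs_triang|].
  rewrite !Rabs_Ropp, Rabs_mult; fold u.
  assert (m * u <= 1 * u) by (apply Rmult_le_compat_r; lra); lra. }
assert (B1 : Rabs (phi (G s) - phi (G t) - d * h)
  <= eps / (2 * (Rabs l + 1)) * Rabs h).
{ destruct (Req_dec h 0) as [h0|h0].
  - replace (G s) with (G t) by (unfold h in h0; lra).
    rewrite h0, Rminus_diag, Rmult_0_r, Rminus_0_r, Rabs_R0; lra.
  - specialize (Hr h h0 Hd1).
    replace (G t + h) with (G s) in Hr by (unfold h; ring).
    replace (phi (G s) - phi (G t) - d * h)
      with (((phi (G s) - phi (G t)) / h - d) * h) by (field; exact h0).
    rewrite Rabs_mult; apply Rmult_le_compat_r; [apply Rabs_pos|lra]. }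
replace (phi (G t) - phi (G s) - d * l * (t - s))
  with (- (phi (G s) - phi (G t) - d * h) + d * (G t - G s - l * (t - s)))
  by (unfold h; ring).
eapply Rle_trans; [apply Rabs_triang|]; rewrite Rabs_Ropp, (Rabs_mult d).
apply Rle_trans with (eps / 2 * u + eps / 2 * u); [|lra].
apply Rplus_le_compat.
- apply Rle_trans with (1 := B1).
  apply Rle_trans with (eps / (2 * (Rabs l + 1)) * ((Rabs l + 1) * u)).
  + apply Rmult_le_compat_l; lra.
  + right; field; lra.
- apply Rle_trans with ((Rabs d + 1) * (eps / (2 * (Rabs d + 1)) * u)).
  + apply Rmult_le_compat; try apply Rabs_pos; try lra.
    apply Rle_trans with (1 := Hd2); apply Rmult_le_compat_r; lra.
  + right; field; lra.
Qed.

(** The mean value inequality: [G t >= G c - eps * (t - c)] propagates along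
    the scale for every [eps > 0].  At the last point only left continuity
    matters, whence the restriction of the sign to [t < d]. *)
Lemma delta_derive_nonneg_incr (G : R -> R) (c d : R) : T c -> T d -> c <= d ->
  (forall t, kappa T t -> c <= t <= d ->
     exists l, is_delta_derive T G t l /\ (t < d -> 0 <= l)) ->
  G c <= G d.
Proof.
intros Tc Td cd HG; apply le_epsilon; intros e He.
set (eps := e / (d - c + 1)).
assert (e0 : 0 < eps) by (apply Rdiv_lt_0_compat; lra).
assert (H : forall t, T t -> c <= t <= d -> G c <= G t + eps * (t - c)).
{ pose proof (T_bounds d Td) as Hd.
  apply scale_ind; [exact Tc|lra| | |].
  - intros t Tt Ht tj IH.
    destruct (HG t (kappa_lt t Tt ltac:(lra)) ltac:(lra)) as [l [Hl l0]].
    specialize (l0 ltac:(lra)).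
    pose proof (delta_derive_step G t l Tt Hl) as Hs.
    assert (0 <= l * (fjump T t - t)) by (apply Rmult_le_pos; lra).
    assert (eps * (t - c) <= eps * (fjump T t - c))
      by (apply Rmult_le_compat_l; lra).
    lra.
  - intros t Tt Ht tb Htj IH.
    destruct (HG t (kappa_lt t Tt ltac:(lra)) ltac:(lra)) as [l [Hl l0]].
    specialize (l0 ltac:(lra)).
    destruct Hl as [_ Hl]; rewrite Htj in Hl.
    destruct (proj1 (locally_Rabs _ _) (Hl (mkposreal _ e0))) as [dl [dl0 Hdl]].
    simpl in Hdl; exists dl; split; [exact dl0|]; intros s Ts Hs sd.
    specialize (Hdl s ltac:(rewrite Rabs_pos_eq; lra) Ts).
    rewrite (Rabs_left1 (t - s)) in Hdl by lra.
    assert (0 <= l * (s - t)) by (apply Rmult_le_pos; lra).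
    pose proof (Rle_abs (G t - G s - l * (t - s))).
    lra.
  - intros t Tt Ht Htj IH.
    assert (kt : kappa T t).
    { apply kappaP; split; [exact Tt|]; rewrite <- Htj.
      apply bjump_mono; auto; lra. }
    destruct (HG t kt ltac:(lra)) as [l [Hl _]].
    pose proof (delta_derive_continuous G t l Hl) as Gc.
    rewrite filterlim_withinP in Gc.
    apply le_epsilon; intros e1 He1; destruct (Gc e1 He1) as [dl [dl0 Hdl]].
    destruct (left_dense_approx t (Rmin dl (t - c)) Tt) as [s [Ts Hs]];
      [pose proof (T_bounds c Tc); lra|exact Htj|apply Rmin_pos; lra|].
    pose proof (Rmin_l dl (t - c)); pose proof (Rmin_r dl (t - c)).
    specialize (IH s Ts ltac:(lra)).
    specialize (Hdl s Ts ltac:(rewrite Rabs_left1; lra)).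
    pose proof (Rle_abs (G s - G t)).
    assert (eps * (s - c) <= eps * (t - c)) by (apply Rmult_le_compat_l; lra).
    lra. }
pose proof (H d Td ltac:(lra)).
assert (eps * (d - c) <= e).
{ apply Rle_trans with (eps * (d - c + 1)); [apply Rmult_le_compat_l; lra|].
  right; unfold eps; field; lra. }
lra.
Qed.

Lemma delta_derive_zero_const (G : R -> R) (c d : R) : T c -> T d -> c <= d ->
  (forall t, kappa T t -> c <= t <= d -> is_delta_derive T G t 0) ->
  G c = G d.
Proof.
intros Tc Td cd HG; apply Rle_antisym.
- apply delta_derive_nonneg_incr; auto.
  intros t kt Ht; exists 0; split; [auto|lra].
- cut (-1 * G c <= -1 * G d); [lra|].
  apply (delta_derive_nonneg_incr (fun s => -1 * G s)); auto.
  intros t kt Ht; exists (-1 * 0); split; [apply delta_derive_scal; auto|lra].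
Qed.

Lemma rd_continuous_derivable (G : R -> R) :
  (forall t, kappa T t -> exists l, is_delta_derive T G t l) ->
  rd_continuous T (kappa T) G.
Proof.
intros HG; apply rd_continuous_continuous; intros t kt.
destruct (HG t kt) as [l Hl].
apply filterlim_within_subset with T; [apply kappa_T|].
exact (delta_derive_continuous G t l Hl).
Qed.

(** * The delta integral of an rd-continuous function *)

(** The integral of [g] over the scale is the Riemann integral of
    [g \o scale_floor], which repeats in each gap the value at its left end. *)
Definition scale_floor (x : R) : R := real (Lub_Rbar (fun s => T s /\ s <= x)).

Lemma scale_floor_spec (x : R) : a <= x ->
  T (scale_floor x) /\ scale_floor x <= x /\
  (forall s, T s -> s <= x -> s <= scale_floor x).
Proof.
intros ax.
destruct (closed_sup (fun s => T s /\ s <= x) x) as [y [Ey [Ty [yx [Hub _]]]]].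
- tauto.
- exists a; split; assumption.
- tauto.
- unfold scale_floor; rewrite Ey; repeat split; auto.
Qed.

Lemma scale_floor_id (t : R) : T t -> scale_floor t = t.
Proof.
intros Tt; destruct (scale_floor_spec t) as [_ [H1 H2]].
- apply T_bounds, Tt.
- apply Rle_antisym; [exact H1|apply H2; [exact Tt|lra]].
Qed.

Lemma scale_floor_gap (t x : R) :
  T t -> t <= x < fjump T t -> scale_floor x = t.
Proof.
intros Tt Hx; pose proof (T_bounds t Tt).
destruct (scale_floor_spec x ltac:(lra)) as [Tf [fx Hf]].
apply Rle_antisym; [|apply Hf; [exact Tt|lra]].
apply Rnot_lt_le; intros tf; pose proof (fjump_le t _ Tt Tf tf); lra.
Qed.

Lemma ex_RInt_step (phi : R -> R) (t t' c : R) : a <= t -> t <= t' ->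
  ex_RInt phi a t -> ex_RInt (fun x => if Rlt_dec x t then phi x else c) a t'.
Proof.
intros at' tt' Hphi; apply ex_RInt_Chasles with t.
- apply ex_RInt_ext with (2 := Hphi); intros x.
  rewrite Rmin_left, Rmax_right by lra; intros Hx.
  destruct (Rlt_dec x t); [reflexivity|lra].
- apply ex_RInt_ext with (fun _ => c); [|apply ex_RInt_const].
  intros x; rewrite Rmin_left, Rmax_right by lra; intros Hx.
  destruct (Rlt_dec x t); [lra|reflexivity].
Qed.

(** The one-sided limits of [g] make its piecewise constant extension
    [g \o scale_floor] uniformly close to step functions: constancy fills the
    gaps of the scale, and near a dense point the extension is nearly constant
    on either side. *)
Lemma floor_step_approx (g : R -> R) (d eps : R) : T d -> 0 < eps ->
  rd_continuous T (ts_itv T a d) g ->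
  exists phi, ex_RInt phi a d /\
    forall x, a <= x < d -> Rabs (g (scale_floor x) - phi x) <= eps.
Proof.
intros Td He Hg; pose proof (T_bounds d Td) as Hd.
pose (ok := fun t => exists phi, ex_RInt phi a t /\
  forall x, a <= x < t -> Rabs (g (scale_floor x) - phi x) <= eps).
assert (glue : forall t t' c, a <= t <= t' -> ok t ->
  (forall x, t <= x < t' -> Rabs (g (scale_floor x) - c) <= eps) -> ok t').
{ intros t t' c Ht [phi [Iphi Hphi]] Hc.
  exists (fun x => if Rlt_dec x t then phi x else c); split.
  - apply ex_RInt_step; auto; lra.
  - intros x Hx; destruct (Rlt_dec x t); [apply Hphi; lra|apply Hc; lra]. }
apply (scale_ind ok a d); [exact Ta| | | | |exact Td|lra].
- exists (fun _ => 0); split; [apply ex_RInt_point|intros; lra].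
- intros t Tt Ht tj Hok; apply (glue t _ (g t)); [lra|exact Hok|].
  intros x Hx; rewrite (scale_floor_gap t x Tt Hx), Rminus_diag, Rabs_R0; lra.
- intros t Tt Ht tb Htj Hok.
  destruct (Hg t) as [Hr _]; [split; [exact Tt|lra]|].
  specialize (Hr Htj); rewrite filterlim_withinP in Hr.
  destruct (Hr eps He) as [dl [dl0 Hdl]].
  exists dl; split; [exact dl0|]; intros s Ts Hs sd.
  apply (glue t _ (g t)); [lra|exact Hok|]; intros x Hx.
  destruct (scale_floor_spec x ltac:(lra)) as [Tf [fx Hf]].
  pose proof (Hf t Tt ltac:(lra)).
  apply Rlt_le, Hdl; [split; [exact Tf|lra]|rewrite Rabs_pos_eq; lra].
- intros t Tt Ht Htj IH.
  destruct (Hg t) as [_ Hl]; [split; [exact Tt|lra]|].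
  destruct (Hl Htj) as [l Hll]; rewrite filterlim_withinP in Hll.
  destruct (Hll eps He) as [dl [dl0 Hdl]].
  destruct (left_dense_approx t (Rmin dl (t - a)) Tt) as [s [Ts Hs]];
    [lra|exact Htj|apply Rmin_pos; lra|].
  pose proof (Rmin_l dl (t - a)); pose proof (Rmin_r dl (t - a)).
  apply (glue s _ l); [lra|apply IH; [exact Ts|lra]|]; intros x Hx.
  destruct (scale_floor_spec x ltac:(lra)) as [Tf [fx Hf]].
  pose proof (Hf s Ts ltac:(lra)).
  apply Rlt_le, Hdl; [repeat split; auto; lra|rewrite Rabs_left1; lra].
Qed.

Lemma ex_RInt_floor (g : R -> R) (d x : R) : T d -> a <= x ->
  rd_continuous T (ts_itv T a d) g ->
  ex_RInt (fun y => g (scale_floor (Rmin y d))) a x.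
Proof.
intros Td ax Hg; pose proof (T_bounds d Td) as Hd.
assert (Id : ex_RInt (fun y => g (scale_floor (Rmin y d))) a d).
{ assert (Hn : forall n : nat, exists phi : R -> R, ex_RInt phi a d /\
    forall y, Rabs (g (scale_floor (Rmin y d)) - phi y) <= / (INR n + 1)).
  { intros n.
    assert (n0 : 0 < / (INR n + 1)).
    { apply Rinv_0_lt_compat; pose proof (pos_INR n); lra. }
    destruct (floor_step_approx g d _ Td n0 Hg) as [phi [Iphi Hphi]].
    exists (fun y => if Rle_dec a y then
      (if Rlt_dec y d then phi y else g (scale_floor (Rmin y d)))
      else g (scale_floor (Rmin y d))); split.
    - apply ex_RInt_ext with (2 := Iphi); intros y.
      rewrite Rmin_left, Rmax_right by lra; intros Hy.
      destruct (Rle_dec a y), (Rlt_dec y d); reflexivity || lra.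
    - intros y; destruct (Rle_dec a y); [|rewrite Rminus_diag, Rabs_R0; lra].
      destruct (Rlt_dec y d); [|rewrite Rminus_diag, Rabs_R0; lra].
      rewrite Rmin_left by lra; apply Hphi; lra. }
  pose (phi := fun n => proj1_sig (constructive_indefinite_description _ (Hn n))).
  assert (Hphi : forall n, ex_RInt (phi n) a d /\
    forall y, Rabs (g (scale_floor (Rmin y d)) - phi n y) <= / (INR n + 1)).
  { intros n; exact (proj2_sig (constructive_indefinite_description _ (Hn n))). }
  destruct (filterlim_RInt phi a d eventually _
    (fun y => g (scale_floor (Rmin y d))) (fun n => RInt (phi n) a d))
    as [I [_ HI]].
  - intros n; apply (RInt_correct (phi n)), Hphi.
  - apply filterlim_locally; intros eps.
    destruct (archimed_cor1 eps (cond_pos eps)) as [N [HN N0]].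
    exists N; intros n Nn y.
    change (Rabs (phi n y - g (scale_floor (Rmin y d))) < eps).
    rewrite Rabs_minus_sym.
    apply Rle_lt_trans with (1 := proj2 (Hphi n) y).
    apply Rle_lt_trans with (2 := HN).
    apply Rinv_le_contravar; [apply lt_0_INR; exact N0|].
    apply le_INR in Nn; lra.
  - exists I; exact HI. }
destruct (Rle_lt_dec x d) as [xd|xd].
- apply ex_RInt_Chasles_1 with (2 := Id); lra.
- apply ex_RInt_Chasles with (1 := Id).
  apply ex_RInt_ext with (fun _ => g d); [|apply ex_RInt_const].
  intros y; rewrite Rmin_left, Rmax_right by lra; intros Hy.
  rewrite Rmin_right by lra; rewrite scale_floor_id; auto.
Qed.

Lemma RInt_near_const (h : R -> R) (s t c eps : R) :
  ex_RInt h s t ->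
  (forall y, Rmin s t <= y <= Rmax s t -> Rabs (h y - c) <= eps) ->
  Rabs (RInt h s t - c * (t - s)) <= eps * Rabs (t - s).
Proof.
intros Ih Hh.
assert (main : forall u v, u <= v -> ex_RInt h u v ->
  (forall y, u <= y <= v -> Rabs (h y - c) <= eps) ->
  Rabs (RInt h u v - c * (v - u)) <= eps * (v - u)).
{ intros u v uv Iuv Huv.
  pose proof (norm_RInt_le_const (fun y => minus (h y) c) u v
    (minus (RInt h u v) (scal (v - u) c)) eps uv Huv) as Hn.
  assert (E : minus (RInt h u v) (scal (v - u) c) = RInt h u v - c * (v - u)).
  { unfold minus, plus, opp, scal; simpl; unfold mult; simpl; ring. }
  rewrite E in Hn; rewrite (Rmult_comm eps); apply Hn; rewrite <- E.
  apply (is_RInt_minus h (fun _ => c));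
    [apply (RInt_correct h); exact Iuv|apply (is_RInt_const (V := R_NormedModule))]. }
destruct (Rle_lt_dec s t) as [st|st].
- rewrite Rmin_left, Rmax_right in Hh by lra.
  rewrite (Rabs_pos_eq (t - s)) by lra; apply main; auto.
- rewrite Rmin_right, Rmax_left in Hh by lra.
  rewrite (Rabs_left1 (t - s)) by lra.
  rewrite <- (opp_RInt_swap h) by (apply ex_RInt_swap; exact Ih).
  change opp with Ropp.
  replace (- RInt h t s - c * (t - s)) with (- (RInt h t s - c * (s - t))) by ring.
  replace (- (t - s)) with (s - t) by ring.
  rewrite Rabs_Ropp; apply main; [lra|apply ex_RInt_swap; exact Ih|exact Hh].
Qed.

(** Derivatives are required up to and including [d], as in the definition of
    the integral over [[a, d]]. *)
Definition delta_antideriv (g : R -> R) (d : R) (G : R -> R) : Prop :=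
  forall t, kappa T t -> t <= d -> is_delta_derive T G t (g t).

(** The Riemann integral of the piecewise constant extension of [g] is an
    antiderivative: across a gap it grows by the length of the gap times the
    value at its left end.  Freezing the extension beyond [d] provides the
    derivative at [d] itself when [d] is right-dense. *)
Lemma delta_antideriv_exists (g : R -> R) (d : R) : T d ->
  rd_continuous T (ts_itv T a d) g -> exists G, delta_antideriv g d G.
Proof.
intros Td Hg; pose proof (T_bounds d Td) as Hd.
set (h := fun y => g (scale_floor (Rmin y d))).
assert (Iax : forall x, a <= x -> ex_RInt h a x).
{ intros x ax; apply ex_RInt_floor; assumption. }
assert (Ixy : forall x y, a <= x -> a <= y -> ex_RInt h x y).
{ intros x y ax ay; apply ex_RInt_Chasles with a;
    [apply ex_RInt_swap|]; auto. }
assert (Hdiff : forall x y, a <= x -> a <= y ->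
  RInt h a y - RInt h a x = RInt h x y).
{ intros x y ax ay; rewrite <- (RInt_Chasles h a x y) by auto.
  unfold plus; simpl; ring. }
destruct (rd_continuous_bounded g d Td Hg) as [M [M0 HM]].
exists (RInt h a); intros t kt td; pose proof (kappa_T t kt) as Tt.
pose proof (T_bounds t Tt) as Hab.
destruct (fjump_ge t Tt) as [tj|tj].
- (* Across the gap after [t] the extension is constantly [g t]; continuity at
     [t] follows from the bound on [g]. *)
  assert (E : RInt h t (fjump T t) = (fjump T t - t) * g t).
  { rewrite (RInt_ext h (fun _ => g t)).
    - rewrite RInt_const; reflexivity.
    - intros y; rewrite Rmin_left, Rmax_right by lra; intros Hy; unfold h.
      rewrite (scale_floor_gap t); [reflexivity|exact Tt|].
      split; [apply Rmin_glb; lra|pose proof (Rmin_l y d); lra]. }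
  replace (g t) with ((RInt h a (fjump T t) - RInt h a t) / (fjump T t - t))
    by (rewrite Hdiff, E by lra; field; lra).
  apply delta_derive_scattered; [exact Tt|exact tj|].
  apply filterlim_withinP; intros eps He.
  exists (eps / (M + 1)); split; [apply Rdiv_lt_0_compat; lra|].
  intros s Ts Hs; pose proof (T_bounds s Ts).
  rewrite Hdiff by lra.
  replace (RInt h t s) with (RInt h t s - 0 * (s - t)) by ring.
  apply Rle_lt_trans with (M * Rabs (s - t)).
  + apply RInt_near_const; [apply Ixy; lra|].
    intros y Hy; rewrite Rminus_0_r.
    assert (ay : a <= Rmin y d).
    { apply Rmin_glb; [|lra]; apply Rle_trans with (2 := proj1 Hy).
      apply Rmin_glb; lra. }
    destruct (scale_floor_spec _ ay) as [Tf [fy Hf]].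
    apply HM; [exact Tf|]; split; [apply T_bounds; exact Tf|].
    pose proof (Rmin_r y d); lra.
  + pose proof (Rabs_pos (s - t)).
    apply Rle_lt_trans with ((M + 1) * Rabs (s - t)).
    * apply Rmult_le_compat_r; lra.
    * replace eps with ((M + 1) * (eps / (M + 1))) by (field; lra).
      apply Rmult_lt_compat_l; lra.
- split; [exact kt|]; intros eps; apply locally_Rabs.
  rewrite <- tj.
  destruct (Hg t) as [Hr _]; [split; [exact Tt|lra]|].
  specialize (Hr (eq_sym tj)); rewrite filterlim_withinP in Hr.
  destruct (Hr eps (cond_pos eps)) as [dl [dl0 Hdl]].
  exists dl; split; [exact dl0|]; intros s Hs Ts.
  pose proof (T_bounds s Ts).
  rewrite Hdiff by lra.
  apply RInt_near_const; [apply Ixy; lra|]; intros y Hy.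
  apply Rlt_le, Hdl.
  + assert (ay : a <= Rmin y d).
    { apply Rmin_glb; [|lra]; apply Rle_trans with (2 := proj1 Hy).
      apply Rmin_glb; lra. }
    destruct (scale_floor_spec _ ay) as [Tf [fy Hf]].
    split; [exact Tf|]; split; [apply T_bounds; exact Tf|].
    pose proof (Rmin_r y d); lra.
  + destruct (Rle_lt_dec s t) as [st|st].
    * rewrite Rmin_left, Rmax_right in Hy by lra.
      rewrite (Rmin_left y d) by lra.
      destruct (scale_floor_spec y ltac:(lra)) as [_ [fy Hf]].
      pose proof (Hf s Ts ltac:(lra)).
      rewrite Rabs_left1 by lra; rewrite Rabs_left1 in Hs by lra; lra.
    * rewrite Rmin_right, Rmax_left in Hy by lra.
      assert (ty : t <= Rmin y d) by (apply Rmin_glb; lra).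
      destruct (scale_floor_spec (Rmin y d) ltac:(lra)) as [_ [fy Hf]].
      pose proof (Hf t Tt ty); pose proof (Rmin_l y d).
      rewrite Rabs_pos_eq by lra; rewrite Rabs_pos_eq in Hs by lra; lra.
Qed.

(** Any two antiderivatives differ by a constant, whichever one the integral
    was computed from. *)
Lemma delta_int_antideriv (g G : R -> R) (d : R) : T d ->
  delta_antideriv g d G -> delta_int T g a d = G d - G a.
Proof.
intros Td HG; pose proof (T_bounds d Td) as Hd; unfold delta_int.
assert (H : is_delta_int T g a d (G d - G a)).
{ exists G; split; [|reflexivity]; intros t kt.
  rewrite Rmin_left, Rmax_right by lra; intros Ht; apply HG; [exact kt|lra]. }
destruct (epsilon_spec (inhabits 0) (is_delta_int T g a d) (ex_intro _ _ H))
  as [K [HK ->]].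
assert (E : K a - G a = K d - G d); [|lra].
apply (delta_derive_zero_const (fun s => K s - G s)); auto; [lra|].
intros t kt Ht; replace 0 with (g t - g t) by ring.
apply delta_derive_minus; [|apply HG; [exact kt|lra]].
apply HK; [exact kt|rewrite Rmin_left, Rmax_right by lra; exact Ht].
Qed.

Lemma delta_antideriv_le (g G : R -> R) (d d' : R) : d' <= d ->
  delta_antideriv g d G -> delta_antideriv g d' G.
Proof. intros dd' HG t kt Ht; apply HG; [exact kt|lra]. Qed.

(** One antiderivative computes the integrals up to all points [t <= d], so
    that derivatives can be taken of the integral as a function of [t].  Beyond
    [d] it is free to differ from the integral. *)
Lemma delta_int_primitive (g : R -> R) (d : R) : T d ->
  rd_continuous T (ts_itv T a d) g ->
  exists G, delta_antideriv g d G /\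
    forall t, T t -> t <= d -> delta_int T g a t = G t.
Proof.
intros Td Hg; destruct (delta_antideriv_exists g d Td Hg) as [G HG].
exists (fun t => G t - G a); split.
- intros t kt td; rewrite <- (Rminus_0_r (g t)).
  apply delta_derive_minus; [exact (HG t kt td)|].
  apply delta_derive_const; exact kt.
- intros t Tt td; apply delta_int_antideriv; [exact Tt|].
  apply delta_antideriv_le with d; assumption.
Qed.

Lemma delta_int_point (g : R -> R) : delta_int T g a a = 0.
Proof.
rewrite (delta_int_antideriv g (fun s => g a * s) a Ta); [ring|].
intros t kt ta; replace t with a
  by (apply Rle_antisym; [apply T_bounds, kappa_T, kt|exact ta]).
assert (ka : kappa T a).
{ apply kappa_le with t; [exact Ta|exact kt|apply T_bounds, kappa_T, kt]. }
pose proof (delta_derive_scal (g a) (fun s => s) a 1 (delta_derive_id a ka)) as H.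
rewrite Rmult_1_r in H; exact H.
Qed.

Lemma delta_int_le_shift (g h : R -> R) (d eta : R) : T d ->
  rd_continuous T (ts_itv T a d) g -> rd_continuous T (ts_itv T a d) h ->
  (forall s, T s -> s < d -> g s <= h s + eta) ->
  delta_int T g a d <= delta_int T h a d + eta * (d - a).
Proof.
intros Td Hg Hh gh; pose proof (T_bounds d Td).
destruct (delta_antideriv_exists g d Td Hg) as [G HG].
destruct (delta_antideriv_exists h d Td Hh) as [K HK].
rewrite (delta_int_antideriv g G d Td HG), (delta_int_antideriv h K d Td HK).
assert (K a + eta * a - G a <= K d + eta * d - G d); [|lra].
apply (delta_derive_nonneg_incr (fun s => K s + eta * s - G s)); auto; [lra|].
intros t kt Ht; exists (h t + eta * 1 - g t); split.
- apply (delta_derive_minus (fun s => K s + eta * s) G).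
  + apply (delta_derive_plus K (fun s => eta * s)); [apply HK; auto; lra|].
    apply (delta_derive_scal eta (fun s => s)), delta_derive_id, kt.
  + apply HG; auto; lra.
- intros td; pose proof (gh t (kappa_T t kt) td); lra.
Qed.

Lemma delta_int_le (g h : R -> R) (d : R) : T d ->
  rd_continuous T (ts_itv T a d) g -> rd_continuous T (ts_itv T a d) h ->
  (forall s, T s -> s < d -> g s <= h s) ->
  delta_int T g a d <= delta_int T h a d.
Proof.
intros Td Hg Hh gh.
pose proof (delta_int_le_shift g h d 0 Td Hg Hh) as H.
rewrite Rmult_0_l, Rplus_0_r in H; apply H.
intros s Ts sd; rewrite Rplus_0_r; auto.
Qed.

Lemma delta_int_scal (g : R -> R) (c d : R) : T d ->
  rd_continuous T (ts_itv T a d) g ->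
  delta_int T (fun s => c * g s) a d = c * delta_int T g a d.
Proof.
intros Td Hg; destruct (delta_antideriv_exists g d Td Hg) as [G HG].
rewrite (delta_int_antideriv g G d Td HG).
rewrite (delta_int_antideriv _ (fun s => c * G s) d Td); [ring|].
intros t kt td; apply delta_derive_scal, HG; assumption.
Qed.

Lemma delta_int_plus (g h : R -> R) (d : R) : T d ->
  rd_continuous T (ts_itv T a d) g -> rd_continuous T (ts_itv T a d) h ->
  delta_int T (fun s => g s + h s) a d
    = delta_int T g a d + delta_int T h a d.
Proof.
intros Td Hg Hh; destruct (delta_antideriv_exists g d Td Hg) as [G HG].
destruct (delta_antideriv_exists h d Td Hh) as [K HK].
rewrite (delta_int_antideriv g G d Td HG), (delta_int_antideriv h K d Td HK).
rewrite (delta_int_antideriv _ (fun s => G s + K s) d Td); [ring|].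
intros t kt td; apply delta_derive_plus; [apply HG|apply HK]; assumption.
Qed.

Lemma delta_int_incr (g : R -> R) (s t : R) : T s -> T t -> s <= t ->
  rd_continuous T (ts_itv T a t) g ->
  (forall r, T r -> s <= r < t -> 0 <= g r) ->
  delta_int T g a s <= delta_int T g a t.
Proof.
intros Ts Tt st Hg g0; destruct (delta_int_primitive g t Tt Hg) as [G [HG E]].
rewrite !E by (auto; lra).
apply delta_derive_nonneg_incr; auto.
intros r kr Hr; exists (g r); split; [apply HG; auto; lra|].
intros rt; apply g0; [apply kappa_T, kr|lra].
Qed.

Lemma delta_int_nonneg (g : R -> R) (d : R) : T d ->
  rd_continuous T (ts_itv T a d) g -> (forall s, T s -> s < d -> 0 <= g s) ->
  0 <= delta_int T g a d.
Proof.
intros Td Hg g0; rewrite <- (delta_int_point g).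
apply delta_int_incr; auto; [apply T_bounds, Td|].
intros r Tr Hr; apply g0; [exact Tr|lra].
Qed.

Lemma delta_int_increment_le (g : R -> R) (s t M : R) : T s -> T t -> s <= t ->
  rd_continuous T (ts_itv T a t) g ->
  (forall r, T r -> s <= r < t -> g r <= M) ->
  delta_int T g a t - delta_int T g a s <= M * (t - s).
Proof.
intros Ts Tt st Hg gM; destruct (delta_int_primitive g t Tt Hg) as [G [HG E]].
rewrite !E by (auto; lra).
assert (M * s - G s <= M * t - G t); [|lra].
apply (delta_derive_nonneg_incr (fun r => M * r - G r)); auto.
intros r kr Hr; exists (M * 1 - g r); split.
- apply delta_derive_minus; [apply delta_derive_scal, delta_derive_id, kr|].
  apply HG; auto; lra.
- intros rt; pose proof (gM r (kappa_T r kr) ltac:(lra)); lra.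
Qed.

(** A bound on [g] is a Lipschitz constant of its integral. *)
Lemma delta_int_continuous (g : R -> R) (d : R) : T d ->
  rd_continuous T (ts_itv T a d) g ->
  forall t, ts_itv T a d t ->
  filterlim (fun s => delta_int T g a s) (within (ts_itv T a d) (locally t))
    (locally (delta_int T g a t)).
Proof.
intros Td Hg; destruct (rd_continuous_bounded g d Td Hg) as [M [M0 HM]].
assert (L : forall s t, T s -> T t -> a <= s -> s <= t <= d ->
  Rabs (delta_int T g a t - delta_int T g a s) <= M * (t - s)).
{ intros s t Ts Tt as' st.
  assert (Hgt : rd_continuous T (ts_itv T a t) g).
  { revert Hg; apply rd_continuous_subset; intros r [Tr Hr].
    split; [exact Tr|lra]. }
  apply Rabs_le; split.
  - pose proof (delta_int_increment_le (fun r => -1 * g r) s t M Ts Tt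
      (proj1 st)) as H1.
    rewrite !delta_int_scal in H1; auto.
    + enough (-1 * delta_int T g a t - -1 * delta_int T g a s <= M * (t - s))
        by lra.
      apply H1.
      * apply rd_continuous_mult; [|exact Hgt].
        apply rd_continuous_continuous; intros r _.
        apply filterlim_within_const.
      * intros r Tr Hr; pose proof (HM r Tr ltac:(lra)) as Hb.
        apply Rabs_le_between in Hb; lra.
    + revert Hg; apply rd_continuous_subset; intros r [Tr Hr].
      split; [exact Tr|lra].
  - apply delta_int_increment_le; auto; [lra|].
    intros r Tr Hr; pose proof (HM r Tr ltac:(lra)) as Hb.
    apply Rabs_le_between in Hb; lra. }
intros t [Tt Ht]; apply filterlim_withinP; intros eps He.
exists (eps / M); split; [apply Rdiv_lt_0_compat; lra|].
intros s [Ts Hs] Hst; apply Rle_lt_trans with (M * Rabs (s - t)).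
- destruct (Rle_lt_dec s t) as [st|st].
  + rewrite Rabs_minus_sym, (Rabs_left1 (s - t)) by lra.
    replace (- (s - t)) with (t - s) by ring; apply L; auto; lra.
  + rewrite (Rabs_pos_eq (s - t)) by lra; apply L; auto; lra.
- replace eps with (M * (eps / M)) by (field; lra).
  apply Rmult_lt_compat_l; lra.
Qed.

Lemma delta_int_ext (g h : R -> R) (d : R) :
  (forall s, T s -> g s = h s) -> delta_int T g a d = delta_int T h a d.
Proof.
intros gh; unfold delta_int; f_equal; apply functional_extensionality; intros I.
apply propositional_extensionality; split; intros [G [HG HI]];
  exists G; split; auto; intros t kt Ht; pose proof (gh t (kappa_T t kt)) as E.
- rewrite <- E; auto.
- rewrite E; auto.
Qed.

(** * The exponential function and Gronwall's inequality *)

(** To the right of a right-dense point, the points of the scale that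
    accumulate there bound the gaps in between. *)
Lemma graininess_right_dense (t : R) : T t -> fjump T t = t ->
  filterlim (fun s => fjump T s - s) (within T (locally t)) (locally 0).
Proof.
intros Tt Htj; apply filterlim_withinP; intros eps He.
assert (Hleft : forall s, T s -> s <= t -> Rabs (s - t) < eps ->
  Rabs (fjump T s - s - 0) < eps).
{ intros s Ts st Hs; rewrite Rabs_left1 in Hs by lra.
  pose proof (fjump_ge s Ts); rewrite Rabs_pos_eq by lra.
  destruct st as [st| ->]; [pose proof (fjump_le s t Ts Tt st)|]; lra. }
destruct (proj2 (T_bounds t Tt)) as [tb|tb].
- destruct (right_dense_approx t eps Tt tb Htj He) as [r [Tr Hr]].
  exists (r - t); split; [lra|]; intros s Ts Hs.
  destruct (Rle_lt_dec s t) as [st|st]; [apply Hleft; auto; lra|].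
  rewrite Rabs_pos_eq in Hs by lra.
  pose proof (fjump_ge s Ts); pose proof (fjump_le s r Ts Tr ltac:(lra)).
  rewrite Rabs_pos_eq; lra.
- exists eps; split; [exact He|]; intros s Ts Hs.
  apply Hleft; auto; rewrite tb; apply T_bounds, Ts.
Qed.

Lemma graininess_left (t : R) : T t ->
  filterlim (fun s => fjump T s - s)
    (within (fun s => T s /\ s < t) (locally t)) (locally 0).
Proof.
intros Tt; apply filterlim_withinP; intros eps He.
exists eps; split; [exact He|]; intros s [Ts st] Hs.
rewrite Rabs_left1 in Hs by lra.
pose proof (fjump_ge s Ts); pose proof (fjump_le s t Ts Tt st).
rewrite Rabs_pos_eq; lra.
Qed.

(** The cylinder transformation: the exponent whose exponential integral grows
    by the factor [1 + mu * f] across a gap of length [mu]. *)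
Definition cylinder (f : R -> R) (s : R) : R :=
  if Rlt_dec s (fjump T s)
  then ln (1 + (fjump T s - s) * f s) / (fjump T s - s) else f s.

Lemma ln_1p_bounds (x : R) : 0 <= x -> x - x * x <= ln (1 + x) <= x.
Proof.
intros x0.
assert (upper : forall y, 0 < y -> ln y <= y - 1).
{ intros y y0; pose proof (exp_ineq1_le (ln y)) as H.
  rewrite exp_ln in H by exact y0; lra. }
split; [|pose proof (upper (1 + x) ltac:(lra)); lra].
pose proof (upper (/ (1 + x)) ltac:(apply Rinv_0_lt_compat; lra)) as H.
rewrite ln_Rinv in H by lra.
assert (x - x * x <= 1 - / (1 + x)); [|lra].
apply Rmult_le_reg_r with (1 + x); [lra|].
replace ((1 - / (1 + x)) * (1 + x)) with x by (field; lra).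
pose proof (Rmult_le_pos _ _ x0 (Rmult_le_pos _ _ x0 x0)); lra.
Qed.

(** The deviation is of the order of the graininess, which vanishes near dense
    points; there [cylinder f] inherits the limits of [f]. *)
Lemma cylinder_close (f : R -> R) (s : R) : T s -> 0 <= f s ->
  Rabs (cylinder f s - f s) <= (fjump T s - s) * (f s * f s).
Proof.
intros Ts f0; unfold cylinder; destruct (Rlt_dec s (fjump T s)) as [sj|sj].
- set (mu := fjump T s - s); assert (mu0 : 0 < mu) by (unfold mu; lra).
  pose proof (ln_1p_bounds (mu * f s) ltac:(apply Rmult_le_pos; lra)) as H.
  assert (0 <= mu * (f s * f s)).
  { apply Rmult_le_pos; [lra|apply Rmult_le_pos; exact f0]. }
  assert (E : mu * (ln (1 + mu * f s) / mu) = ln (1 + mu * f s)) by (field; lra).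
  apply Rabs_le; split; apply Rmult_le_reg_l with mu; try exact mu0;
    rewrite Rmult_minus_distr_l, E; [lra|].
  assert (0 <= mu * (mu * (f s * f s))) by (apply Rmult_le_pos; lra); lra.
- rewrite Rminus_diag, Rabs_R0; pose proof (fjump_ge s Ts).
  apply Rmult_le_pos; [lra|apply Rmult_le_pos; exact f0].
Qed.

Lemma cylinder_lim (f : R -> R) (D : R -> Prop) (t l : R) :
  (forall s, D s -> T s /\ 0 <= f s) ->
  filterlim (fun s => fjump T s - s) (within D (locally t)) (locally 0) ->
  filterlim f (within D (locally t)) (locally l) ->
  filterlim (cylinder f) (within D (locally t)) (locally l).
Proof.
intros HD Hmu Hf.
pose proof (filterlim_within_mult _ _ _ _ _ _ Hmu
  (filterlim_within_mult _ _ _ _ _ _ Hf Hf)) as Herr.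
rewrite Rmult_0_l in Herr.
rewrite filterlim_withinP in Hf, Herr |- *; intros eps He.
destruct (Hf (eps / 2) ltac:(lra)) as [d1 [d10 H1]].
destruct (Herr (eps / 2) ltac:(lra)) as [d2 [d20 H2]].
exists (Rmin d1 d2); split; [apply Rmin_pos; assumption|]; intros s Ds Hs.
pose proof (Rmin_l d1 d2); pose proof (Rmin_r d1 d2).
specialize (H1 s Ds ltac:(lra)); specialize (H2 s Ds ltac:(lra)).
destruct (HD s Ds) as [Ts f0]; pose proof (cylinder_close f s Ts f0) as H3.
replace (cylinder f s - l) with ((cylinder f s - f s) + (f s - l)) by ring.
eapply Rle_lt_trans; [apply Rabs_triang|].
rewrite Rminus_0_r in H2; pose proof (Rle_abs ((fjump T s - s) * (f s * f s))).
lra.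
Qed.

Lemma cylinder_rd (f : R -> R) : (forall t, kappa T t -> 0 <= f t) ->
  rd_continuous T (kappa T) f -> rd_continuous T (kappa T) (cylinder f).
Proof.
intros f0 Hf t kt; destruct (Hf t kt) as [Hr Hl].
pose proof (kappa_T t kt) as Tt; split.
- intros Htj.
  replace (cylinder f t) with (f t)
    by (unfold cylinder; destruct (Rlt_dec t (fjump T t)); [lra|reflexivity]).
  apply cylinder_lim; [intros s ks; split; [apply kappa_T, ks|auto]| |auto].
  apply filterlim_within_subset with T; [apply kappa_T|].
  apply graininess_right_dense; assumption.
- intros Htj; destruct (Hl Htj) as [l Hll]; exists l.
  apply cylinder_lim; [intros s [ks _]; split; [apply kappa_T, ks|auto]| |auto].
  apply filterlim_within_subset with (2 := graininess_left t Tt).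
  intros s [ks st]; split; [apply kappa_T, ks|exact st].
Qed.

(** [c = 1] and [c = -1] give the exponential function and its reciprocal. *)
Lemma delta_derive_exp (f G : R -> R) (t c : R) : kappa T t -> 0 <= f t ->
  is_delta_derive T G t (cylinder f t) ->
  is_delta_derive T (fun s => exp (c * G s)) t
    (if Rlt_dec t (fjump T t)
     then (exp (c * ln (1 + (fjump T t - t) * f t)) - 1) / (fjump T t - t)
       * exp (c * G t)
     else c * f t * exp (c * G t)).
Proof.
intros kt f0 HG; pose proof (kappa_T t kt) as Tt.
pose proof (delta_derive_step G t _ Tt HG) as Hs.
pose proof (delta_derive_scal c G t _ HG) as HcG.
unfold cylinder in *; destruct (Rlt_dec t (fjump T t)) as [tj|tj].
- set (mu := fjump T t - t) in *; assert (mu0 : 0 < mu) by (unfold mu; lra).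
  replace (ln (1 + mu * f t) / mu * mu) with (ln (1 + mu * f t)) in Hs
    by (field; lra).
  replace ((exp (c * ln (1 + mu * f t)) - 1) / mu * exp (c * G t))
    with ((exp (c * G (fjump T t)) - exp (c * G t)) / mu).
  + apply (delta_derive_scattered (fun s => exp (c * G s))); auto.
    apply (filterlim_within_comp T exp (fun s => c * G s));
      [apply continuous_exp|].
    exact (delta_derive_continuous _ _ _ HcG).
  + rewrite <- Hs.
    replace (c * G (fjump T t)) with (c * (G (fjump T t) - G t) + c * G t)
      by ring.
    rewrite exp_plus; field; lra.
- replace (c * f t * exp (c * G t)) with (exp (c * G t) * (c * f t)) by ring.
  apply (delta_derive_comp_dense exp (fun s => c * G s)); auto.
  + apply Rle_antisym; [lra|apply fjump_ge, Tt].
  + apply is_derive_exp.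
Qed.

(** Carrying the reciprocal [w] along, with a derivative of its own, replaces
    the quotient rule by the product rule. *)
Record exp_pair (f E w : R -> R) : Prop := {
  exp_pair_start : E a = 1;
  exp_pair_inv : forall t, E t * w t = 1;
  exp_pair_pos : forall t, 0 < E t /\ 0 < w t;
  exp_pair_derive : forall t, kappa T t -> is_delta_derive T E t (f t * E t);
  exp_pair_derive_inv : forall t, kappa T t ->
    is_delta_derive T w t (- (f t * w (fjump T t))) }.

Lemma exp_pair_exists (f : R -> R) : (forall t, kappa T t -> 0 <= f t) ->
  rd_continuous T (kappa T) f -> exists E w, exp_pair f E w.
Proof.
intros f0 Hf.
destruct (delta_int_primitive (cylinder f) b Tb) as [G [HG EG]].
{ apply rd_continuous_kappa, cylinder_rd; assumption. }
assert (Ga : G a = 0).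
{ rewrite <- EG by (auto; apply T_bounds, Ta); apply delta_int_point. }
assert (Htb : forall t, kappa T t -> t <= b).
{ intros t kt; apply T_bounds, kappa_T, kt. }
exists (fun s => exp (1 * G s)), (fun s => exp (-1 * G s)); split.
- rewrite Ga, Rmult_0_r; apply exp_0.
- intros t; rewrite <- exp_plus.
  replace (1 * G t + -1 * G t) with 0 by ring; apply exp_0.
- intros t; split; apply exp_pos.
- intros t kt.
  pose proof (delta_derive_exp f G t 1 kt (f0 t kt) (HG t kt (Htb t kt))) as H.
  revert H; destruct (Rlt_dec t (fjump T t)) as [tj|tj];
    [|rewrite Rmult_1_l; trivial].
  assert (0 < 1 + (fjump T t - t) * f t).
  { assert (0 <= (fjump T t - t) * f t)
      by (apply Rmult_le_pos; [lra|apply f0; exact kt]).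
    lra. }
  rewrite !Rmult_1_l, exp_ln by assumption.
  replace ((1 + (fjump T t - t) * f t - 1) / (fjump T t - t)) with (f t)
    by (field; lra); trivial.
- intros t kt.
  pose proof (HG t kt (Htb t kt)) as HGt.
  pose proof (delta_derive_exp f G t (-1) kt (f0 t kt) HGt) as H.
  pose proof (delta_derive_step G t _ (kappa_T t kt) HGt) as Hs.
  unfold cylinder in Hs.
  revert H; destruct (Rlt_dec t (fjump T t)) as [tj|tj].
  + set (mu := fjump T t - t) in *; assert (mu0 : 0 < mu) by (unfold mu; lra).
    assert (v0 : 0 < 1 + mu * f t).
    { pose proof (Rmult_le_pos _ _ (Rlt_le _ _ mu0) (f0 t kt)); lra. }
    replace (ln (1 + mu * f t) / mu * mu) with (ln (1 + mu * f t)) in Hs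
      by (field; lra).
    replace (-1 * G (fjump T t)) with (-1 * ln (1 + mu * f t) + -1 * G t) by lra.
    replace (-1 * ln (1 + mu * f t)) with (- ln (1 + mu * f t)) by ring.
    rewrite exp_plus, exp_Ropp, exp_ln by exact v0.
    replace ((/ (1 + mu * f t) - 1) / mu * exp (-1 * G t))
      with (- (f t * (/ (1 + mu * f t) * exp (-1 * G t))))
      by (field; lra); trivial.
  + replace (fjump T t) with t
      by (apply Rle_antisym; [apply fjump_ge, kappa_T, kt|lra]).
    replace (- (f t * exp (-1 * G t))) with (-1 * f t * exp (-1 * G t)) by ring.
    trivial.
Qed.

Lemma delta_exp_pair (f E w : R -> R) (t t0 : R) : exp_pair f E w ->
  T t -> T t0 -> delta_exp T f t t0 = E t * w t0.
Proof.
intros [Ea Einv Epos Eder wder] Tt Tt0; unfold delta_exp.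
assert (Hex : exists y, is_delta_exp T f t0 y).
{ exists (fun s => w t0 * E s); split; [rewrite Rmult_comm; apply Einv|].
  intros s ks; replace (f s * (w t0 * E s)) with (w t0 * (f s * E s)) by ring.
  apply delta_derive_scal, Eder, ks. }
destruct (epsilon_spec (inhabits (fun _ => 0)) _ Hex) as [y0 yder].
set (y := epsilon _ _) in *.
(* The quotient of two solutions is constant. *)
assert (Hc : forall s, T s -> y a * w a = y s * w s).
{ intros s Ts; apply (delta_derive_zero_const (fun r => y r * w r)); auto.
  - apply T_bounds, Ts.
  - intros r kr _.
    replace 0 with (f r * y r * w (fjump T r) + y r * - (f r * w (fjump T r)))
      by ring.
    apply delta_derive_mult; auto. }
pose proof (Hc t Tt) as H1; pose proof (Hc t0 Tt0) as H2.
rewrite y0, Rmult_1_l in H2; rewrite <- H2, H1.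
rewrite (Rmult_comm (y t)), <- Rmult_assoc, Einv; ring.
Qed.

(** Since [- E t * w] is an antiderivative of [s |-> f s * E t * w (sigma s)],
    the integral telescopes: [p] is itself the exponential function. *)
Lemma delta_int_exp (f E w : R -> R) (t : R) : exp_pair f E w -> T t ->
  1 + delta_int T (fun s => f s * delta_exp T f t (fjump T s)) a t = E t.
Proof.
intros HE Tt.
rewrite (delta_int_antideriv _ (fun s => - E t * w s) t Tt).
- pose proof (exp_pair_inv _ _ _ HE t); pose proof (exp_pair_inv _ _ _ HE a).
  rewrite (exp_pair_start _ _ _ HE) in *.
  replace (w a) with 1 by lra; lra.
- intros s ks st; pose proof (kappa_T s ks) as Ts.
  rewrite (delta_exp_pair f E w) by auto using T_fjump.
  replace (f s * (E t * w (fjump T s))) with (- E t * - (f s * w (fjump T s)))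
    by ring.
  apply delta_derive_scal, exp_pair_derive_inv with (1 := HE); exact ks.
Qed.

Lemma exp_pair_incr (f E w : R -> R) (s t : R) : exp_pair f E w ->
  (forall r, kappa T r -> 0 <= f r) -> T s -> T t -> s <= t -> E s <= E t.
Proof.
intros HE f0 Ts Tt st; apply delta_derive_nonneg_incr; auto.
intros r kr Hr; exists (f r * E r); split; [apply (exp_pair_derive _ _ _ HE); auto|].
intros _; apply Rmult_le_pos; [auto|apply Rlt_le, (exp_pair_pos _ _ _ HE)].
Qed.

(** Gronwall's inequality: the hypothesis says that the derivative of
    [(Z + I) * w], where [I] is the integral, is nonpositive. *)
Lemma delta_gronwall (f E w u : R -> R) (Z t : R) : exp_pair f E w ->
  (forall s, kappa T s -> 0 <= f s) -> T t ->
  rd_continuous T (ts_itv T a t) (fun s => f s * u s) ->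
  (forall s, T s -> s < t -> u s <= Z + delta_int T (fun r => f r * u r) a s) ->
  Z + delta_int T (fun r => f r * u r) a t <= E t * Z.
Proof.
intros HE f0 Tt Hfu Hu; pose proof (T_bounds t Tt) as Ht.
destruct (delta_int_primitive _ t Tt Hfu) as [G [HG EG]].
assert (Ga : G a = 0).
{ rewrite <- EG by (auto; lra); apply delta_int_point. }
rewrite EG by (auto; lra).
assert (wa : w a = 1).
{ pose proof (exp_pair_inv _ _ _ HE a); rewrite (exp_pair_start _ _ _ HE) in *.
  lra. }
assert (main : -1 * ((G a + Z) * w a) <= -1 * ((G t + Z) * w t)).
{ apply (delta_derive_nonneg_incr (fun s => -1 * ((G s + Z) * w s))); auto;
    [lra|].
  intros s ks Hs; pose proof (kappa_T s ks) as Ts.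
  exists (-1 * ((f s * u s + 0) * w (fjump T s)
    + (G s + Z) * - (f s * w (fjump T s)))); split.
  - apply (delta_derive_scal (-1) (fun r => (G r + Z) * w r)).
    apply (delta_derive_mult (fun r => G r + Z) w).
    + apply (delta_derive_plus G (fun _ => Z));
        [apply HG; auto; lra|exact (delta_derive_const Z s ks)].
    + apply (exp_pair_derive_inv _ _ _ HE), ks.
  - intros st; specialize (Hu s Ts st); rewrite EG in Hu by (auto; lra).
    replace (-1 * ((f s * u s + 0) * w (fjump T s)
      + (G s + Z) * - (f s * w (fjump T s))))
      with (f s * w (fjump T s) * (Z + G s - u s)) by ring.
    apply Rmult_le_pos; [|lra].
    apply Rmult_le_pos; [auto|apply Rlt_le, (exp_pair_pos _ _ _ HE)]. }
rewrite Ga, wa in main.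
destruct (exp_pair_pos _ _ _ HE t) as [Et _].
pose proof (exp_pair_inv _ _ _ HE t) as Hinv.
apply Rle_trans with (E t * ((G t + Z) * w t)).
- replace (E t * ((G t + Z) * w t)) with ((E t * w t) * (G t + Z)) by ring.
  rewrite Hinv; lra.
- apply Rmult_le_compat_l; lra.
Qed.

(** * Integrals against the kernel *)

Section Kernel.

Context (k : R -> R -> R) (k_cond : kernel_cond T a k).
Context (k_nonneg : forall t s, T t -> T s -> s <= t -> 0 <= k t s).
Context (k_derive_nonneg : forall t s, T t -> T s -> s <= t ->
  ex_delta_derive T (fun x => k x s) t ->
  0 <= delta_derive T (fun x => k x s) t).

(** The kernel is assumed differentiable only at points [t > a], whence the
    strict inequality. *)
Lemma kernel_mono (s t tau : R) :
  T s -> T t -> T tau -> a < s -> s <= t -> tau <= s -> k s tau <= k t tau.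
Proof.
intros Ts Tt Ttau as' st taus.
apply (delta_derive_nonneg_incr (fun x => k x tau)); auto.
intros r kr Hr; pose proof (kappa_T r kr) as Tr.
destruct (k_cond r kr ltac:(lra)) as [_ [_ [Hex _]]].
specialize (Hex tau); assert (Hd : ex_delta_derive T (fun x => k x tau) r).
{ apply Hex; split; [exact Ttau|]; split; [apply T_bounds, Ttau|].
  pose proof (fjump_ge r Tr); lra. }
exists (delta_derive T (fun x => k x tau) r); split.
- destruct Hd as [l [Hl _]].
  exact (epsilon_spec (inhabits 0) _ (ex_intro _ l Hl)).
- intros _; apply k_derive_nonneg; auto; lra.
Qed.

Lemma kernel_rd (s : R) : kappa T s -> rd_continuous T (ts_itv T a s) (k s).
Proof.
intros ks; pose proof (kappa_T s ks) as Ts.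
destruct (proj1 (T_bounds s Ts)) as [as'| <-]; [|apply rd_continuous_point].
destruct (k_cond s ks as') as [_ [Hrd _]].
revert Hrd; apply rd_continuous_subset; intros r [Tr Hr].
split; [exact Tr|]; pose proof (fjump_ge s Ts); lra.
Qed.

(** The derivative quotients converge uniformly in [tau], so that the
    derivative differs from the quotient at a single [s1] by at most [1]; this
    bounds it on the common domain of [k t] and [k s1]. *)
Lemma kernel_lipschitz (t : R) : kappa T t -> a < t -> fjump T t = t ->
  exists delta, 0 < delta /\
    forall s1, kappa T s1 -> Rabs (s1 - t) < delta -> s1 <> t ->
    exists L, 0 <= L /\ forall s tau, T s -> Rabs (s - t) < delta ->
      T tau -> tau <= s1 -> tau <= t ->
      Rabs (k t tau - k s tau) <= L * Rabs (t - s).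
Proof.
intros kt at' Htj; pose proof (kappa_T t kt) as Tt.
destruct (k_cond t kt at') as [_ [_ [_ Hunif]]].
destruct (proj1 (locally_Rabs _ _) (Hunif (mkposreal 1 Rlt_0_1)))
  as [dl [dl0 Hdl]].
simpl in Hdl; rewrite Htj in Hdl.
exists dl; split; [exact dl0|]; intros s1 ks1 Hs1 s1t.
destruct (rd_continuous_bounded _ t Tt (kernel_rd t kt)) as [M [M0 HM]].
destruct (rd_continuous_bounded _ s1 (kappa_T s1 ks1) (kernel_rd s1 ks1))
  as [M1 [M10 HM1]].
pose proof (Rabs_pos_lt (t - s1) ltac:(lra)) as u0.
set (B := 1 + (M + M1) / Rabs (t - s1)).
assert (B0 : 0 <= (M + M1) / Rabs (t - s1)).
{ apply Rlt_le, Rdiv_lt_0_compat; lra. }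
exists (B + 1); split; [unfold B; lra|].
intros s tau Ts Hs Ttau taus1 taut.
assert (Htau : ts_itv T a t tau).
{ split; [exact Ttau|split; [apply T_bounds, Ttau|exact taut]]. }
pose proof (Hdl s Hs Ts tau Htau) as H.
pose proof (Hdl s1 Hs1 (kappa_T s1 ks1) tau Htau) as H1.
set (D := delta_derive T (fun x => k x tau) t) in *.
assert (HD : Rabs D <= B).
{ apply Rmult_le_reg_r with (Rabs (t - s1)); [exact u0|].
  replace (B * Rabs (t - s1)) with (Rabs (t - s1) + (M + M1))
    by (unfold B; field; lra).
  rewrite <- Rabs_mult.
  pose proof (HM tau Ttau (proj2 Htau)).
  pose proof (HM1 tau Ttau ltac:(split; [apply T_bounds, Ttau|exact taus1])).
  replace (D * (t - s1)) with
    (- (k t tau - k s1 tau - D * (t - s1)) + (k t tau - k s1 tau)) by ring.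
  eapply Rle_trans; [apply Rabs_triang|]; rewrite Rabs_Ropp.
  assert (Rabs (k t tau - k s1 tau) <= M + M1); [|lra].
  unfold Rminus at 1; eapply Rle_trans; [apply Rabs_triang|].
  rewrite Rabs_Ropp; lra. }
replace (k t tau - k s tau)
  with ((k t tau - k s tau - D * (t - s)) + D * (t - s)) by ring.
eapply Rle_trans; [apply Rabs_triang|]; rewrite Rabs_mult.
pose proof (Rabs_pos (t - s)) as u1.
pose proof (Rmult_le_compat_r _ _ _ u1 HD); lra.
Qed.

Definition kernel_int (g : R -> R) (s : R) : R :=
  delta_int T (fun tau => k s tau * g tau) a s.

Section Weight.

Context (g : R -> R) (g_rd : rd_continuous T (kappa T) g).
Context (g_nonneg : forall t, kappa T t -> 0 <= g t).

Lemma kernel_weight_rd (s : R) : kappa T s ->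
  rd_continuous T (ts_itv T a s) (fun tau => k s tau * g tau).
Proof.
intros ks; apply rd_continuous_mult;
  [apply kernel_rd, ks|apply rd_continuous_kappa; [apply kappa_T, ks|exact g_rd]].
Qed.

Lemma kernel_weight_nonneg (s tau : R) : kappa T s -> T tau -> tau <= s ->
  0 <= k s tau * g tau.
Proof.
intros ks Ttau H; apply Rmult_le_pos.
- apply k_nonneg; [apply kappa_T, ks|exact Ttau|exact H].
- apply g_nonneg, kappa_le with s; assumption.
Qed.

(** Replacing [k s] by [k t] with a larger first argument [t] makes the
    integral an ordinary one, with an integrand independent of its end [s]. *)
Lemma kernel_int_freeze (s t : R) : T s -> kappa T t -> s <= t ->
  kernel_int g s <= delta_int T (fun tau => k t tau * g tau) a s.
Proof.
intros Ts kt st; pose proof (kappa_T t kt) as Tt; unfold kernel_int.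
destruct (proj1 (T_bounds s Ts)) as [as'| <-];
  [|rewrite !delta_int_point; lra].
assert (ks : kappa T s) by (apply kappa_le with t; assumption).
apply delta_int_le; [exact Ts|apply kernel_weight_rd, ks| |].
- apply rd_continuous_itv_le with t; [exact st|apply kernel_weight_rd, kt].
- intros tau Ttau taus; apply Rmult_le_compat_r.
  + apply g_nonneg, kappa_le with t; auto; lra.
  + apply kernel_mono; auto; lra.
Qed.

Lemma kernel_int_mono (s t : R) : T s -> kappa T t -> s <= t ->
  kernel_int g s <= kernel_int g t.
Proof.
intros Ts kt st; pose proof (kappa_T t kt) as Tt.
apply Rle_trans with (1 := kernel_int_freeze s t Ts kt st).
apply delta_int_incr; auto; [apply kernel_weight_rd, kt|].
intros r Tr Hr; apply kernel_weight_nonneg; auto; lra.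
Qed.

Lemma kernel_int_nonneg (s : R) : kappa T s -> 0 <= kernel_int g s.
Proof.
intros ks; pose proof (kappa_T s ks) as Ts.
apply delta_int_nonneg; [exact Ts|apply kernel_weight_rd, ks|].
intros r Tr rs; apply kernel_weight_nonneg; auto; lra.
Qed.

(** The increment splits into the integral of [k s] beyond [t] and that of
    [k s - k t] up to [t]; the latter is empty at [t = a], where nothing is
    assumed of the derivative of the kernel. *)
Lemma kernel_int_right (t eps : R) : T t -> t < b -> fjump T t = t -> 0 < eps ->
  exists delta, 0 < delta /\ forall s, T s -> t < s < t + delta ->
    kernel_int g s <= kernel_int g t + eps.
Proof.
intros Tt tb Htj He; pose proof (T_bounds t Tt) as Ht.
assert (Hs1 : exists s1 L, T s1 /\ t < s1 < b /\ 0 <= L /\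
  forall s tau, T s -> t < s <= s1 -> T tau -> tau < t ->
    k s tau <= k t tau + L * (s - t)).
{ destruct (proj1 Ht) as [at'|at'].
  - pose proof (kappa_lt t Tt tb) as kt.
    destruct (kernel_lipschitz t kt at' Htj) as [dl [dl0 Hdl]].
    destruct (right_dense_approx t (Rmin dl (b - t)) Tt tb Htj) as [s1 [Ts1 Hs1]];
      [apply Rmin_pos; lra|].
    pose proof (Rmin_l dl (b - t)); pose proof (Rmin_r dl (b - t)).
    destruct (Hdl s1) as [L [L0 HL]];
      [apply kappa_lt; auto; lra|rewrite Rabs_pos_eq; lra|lra|].
    exists s1, L; repeat split; auto; try lra.
    intros s tau Ts Hs Ttau taut.
    pose proof (HL s tau Ts ltac:(rewrite Rabs_pos_eq; lra) Ttau ltac:(lra)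
      ltac:(lra)) as H1.
    rewrite (Rabs_left1 (t - s)) in H1 by lra.
    apply Rabs_le_between in H1; lra.
  - destruct (right_dense_approx t (b - t) Tt tb Htj) as [s1 [Ts1 Hs1]]; [lra|].
    exists s1, 0; repeat split; auto; try lra.
    intros s tau _ _ Ttau taut; pose proof (T_bounds tau Ttau); lra. }
destruct Hs1 as [s1 [L [Ts1 [Hs1 [L0 HL]]]]].
assert (ks1 : kappa T s1) by (apply kappa_lt; auto; lra).
destruct (rd_continuous_bounded _ s1 Ts1 (kernel_weight_rd s1 ks1))
  as [M [M0 HM]].
destruct (rd_continuous_bounded g t Tt (rd_continuous_kappa g t Tt g_rd))
  as [C [C0 HC]].
(* [M] bounds the part of the integral beyond [t], and [L * C] the growth of
   the integrand before [t], both per unit of [s - t]. *)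
set (N := M + L * C * (t - a)).
assert (N0 : 0 < N).
{ unfold N; apply Rplus_lt_le_0_compat; [exact M0|].
  repeat apply Rmult_le_pos; lra. }
exists (Rmin (s1 - t) (eps / N)); split.
{ apply Rmin_pos; [lra|apply Rdiv_lt_0_compat; assumption]. }
intros s Ts Hs.
pose proof (Rmin_l (s1 - t) (eps / N)); pose proof (Rmin_r (s1 - t) (eps / N)).
assert (ks : kappa T s) by (apply kappa_le with s1; auto; lra).
assert (kt : kappa T t) by (apply kappa_lt; assumption).
pose proof (kernel_weight_rd s ks) as Hrd.
assert (A1 : kernel_int g s - delta_int T (fun tau => k s tau * g tau) a t
  <= M * (s - t)).
{ apply delta_int_increment_le; auto; [lra|]; intros r Tr Hr.
  apply Rle_trans with (k s1 r * g r).
  - apply Rmult_le_compat_r; [|apply kernel_mono; auto; lra].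
    apply g_nonneg, kappa_le with s; auto; lra.
  - eapply Rle_trans; [apply Rle_abs|apply HM; auto; lra]. }
assert (A2 : delta_int T (fun tau => k s tau * g tau) a t
  <= kernel_int g t + L * (s - t) * C * (t - a)).
{ apply delta_int_le_shift; auto.
  - apply rd_continuous_itv_le with s; [lra|exact Hrd].
  - apply kernel_weight_rd, kt.
  - intros r Tr rt.
    pose proof (HL s r Ts ltac:(lra) Tr rt) as Hk.
    pose proof (g_nonneg r ltac:(apply kappa_le with t; auto; lra)) as gr0.
    pose proof (Rmult_le_compat_r _ _ _ gr0 Hk).
    pose proof (HC r Tr ltac:(pose proof (T_bounds r Tr); lra)) as HCr.
    rewrite Rabs_pos_eq in HCr by exact gr0.
    assert (L * (s - t) * g r <= L * (s - t) * C); [|lra].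
    apply Rmult_le_compat_l; [apply Rmult_le_pos; lra|exact HCr]. }
assert (N * (s - t) <= eps).
{ replace eps with (N * (eps / N)) by (field; lra).
  apply Rmult_le_compat_l; lra. }
unfold N in *; lra.
Qed.

(** Only [tau <= c] for some [c < t] admits the Lipschitz bound, [k s tau]
    being out of control for [tau > s]; the rest of the integral is small. *)
Lemma kernel_int_left (t eps : R) : kappa T t -> a < t -> fjump T t = t ->
  bjump T t = t -> 0 < eps ->
  exists delta, 0 < delta /\ forall s, T s -> t - delta < s < t ->
    kernel_int g t <= kernel_int g s + eps.
Proof.
intros kt at' Htj Hlj He; pose proof (kappa_T t kt) as Tt.
destruct (kernel_lipschitz t kt at' Htj) as [dl [dl0 Hdl]].
destruct (rd_continuous_bounded _ t Tt (kernel_weight_rd t kt)) as [M [M0 HM]].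
destruct (rd_continuous_bounded g t Tt (rd_continuous_kappa g t Tt g_rd))
  as [C [C0 HC]].
assert (e2 : 0 < eps / (2 * M)) by (apply Rdiv_lt_0_compat; lra).
destruct (left_dense_approx t (Rmin (Rmin dl (t - a)) (eps / (2 * M))) Tt)
  as [c [Tc Hc]]; [exact at'|exact Hlj|repeat apply Rmin_pos; lra|].
pose proof (Rmin_l (Rmin dl (t - a)) (eps / (2 * M))).
pose proof (Rmin_r (Rmin dl (t - a)) (eps / (2 * M))).
pose proof (Rmin_l dl (t - a)); pose proof (Rmin_r dl (t - a)).
assert (kc : kappa T c) by (apply kappa_le with t; auto; lra).
destruct (Hdl c kc) as [L [L0 HL]]; [rewrite Rabs_left1; lra|lra|].
(* The added 1 only makes [N] positive. *)
set (N := L * C * (c - a) + 1).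
assert (N0 : 0 < N).
{ unfold N; apply Rplus_le_lt_0_compat; [|lra].
  repeat apply Rmult_le_pos; lra. }
exists (Rmin (t - c) (eps / (2 * N))); split.
{ apply Rmin_pos; [lra|apply Rdiv_lt_0_compat; lra]. }
intros s Ts Hs.
pose proof (Rmin_l (t - c) (eps / (2 * N))).
pose proof (Rmin_r (t - c) (eps / (2 * N))).
assert (ks : kappa T s) by (apply kappa_le with t; auto; lra).
assert (A1 : kernel_int g t - delta_int T (fun tau => k t tau * g tau) a c
  <= M * (t - c)).
{ apply delta_int_increment_le; auto; [lra|apply kernel_weight_rd, kt|].
  intros r Tr Hr; eapply Rle_trans; [apply Rle_abs|apply HM; auto; lra]. }
assert (A2 : delta_int T (fun tau => k t tau * g tau) a c
  <= delta_int T (fun tau => k s tau * g tau) a c + L * (t - s) * C * (c - a)).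
{ apply delta_int_le_shift; auto.
  - apply rd_continuous_itv_le with t; [lra|apply kernel_weight_rd, kt].
  - apply rd_continuous_itv_le with s; [lra|apply kernel_weight_rd, ks].
  - intros r Tr rc; pose proof (T_bounds r Tr).
    pose proof (HL s r Ts ltac:(rewrite Rabs_left1; lra) Tr ltac:(lra)
      ltac:(lra)) as Hk.
    rewrite (Rabs_pos_eq (t - s)) in Hk by lra; apply Rabs_le_between in Hk.
    pose proof (g_nonneg r ltac:(apply kappa_le with t; auto; lra)) as gr0.
    assert (Hk' : k t r <= k s r + L * (t - s)) by lra.
    pose proof (Rmult_le_compat_r _ _ _ gr0 Hk').
    pose proof (HC r Tr ltac:(lra)) as HCr.
    rewrite Rabs_pos_eq in HCr by exact gr0.
    assert (L * (t - s) * g r <= L * (t - s) * C); [|lra].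
    apply Rmult_le_compat_l; [apply Rmult_le_pos; lra|exact HCr]. }
assert (A3 : delta_int T (fun tau => k s tau * g tau) a c <= kernel_int g s).
{ apply delta_int_incr; auto; [lra|apply kernel_weight_rd, ks|].
  intros r Tr Hr; apply kernel_weight_nonneg; auto; lra. }
assert (A4 : N * (t - s) <= eps / 2).
{ replace (eps / 2) with (N * (eps / (2 * N))) by (field; lra).
  apply Rmult_le_compat_l; lra. }
assert (A5 : M * (t - c) <= eps / 2).
{ replace (eps / 2) with (M * (eps / (2 * M))) by (field; lra).
  apply Rmult_le_compat_l; lra. }
unfold N in A4; lra.
Qed.

Lemma kernel_int_continuous (t : R) : kappa T t -> fjump T t = t ->
  filterlim (kernel_int g) (within (kappa T) (locally t))
    (locally (kernel_int g t)).
Proof.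
intros kt Htj; pose proof (kappa_T t kt) as Tt.
pose proof (T_bounds t Tt) as Ht.
apply filterlim_withinP; intros eps He.
assert (Hr : exists d, 0 < d /\ forall s, T s -> t < s < t + d ->
  kernel_int g s <= kernel_int g t + eps / 2).
{ destruct (proj2 Ht) as [tb|tb].
  - apply kernel_int_right; auto; lra.
  - exists 1; split; [lra|]; intros s Ts Hs; pose proof (T_bounds s Ts); lra. }
assert (Hl : exists d, 0 < d /\ forall s, T s -> t - d < s < t ->
  kernel_int g t <= kernel_int g s + eps / 2).
{ destruct (proj1 Ht) as [at'|at'].
  - destruct (bjump_le t Tt) as [jt|jt].
    + exists (t - bjump T t); split; [lra|]; intros s Ts Hs.
      pose proof (bjump_ge t s Tt Ts ltac:(lra)); lra.
    + apply kernel_int_left; auto; lra.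
  - exists 1; split; [lra|]; intros s Ts Hs; pose proof (T_bounds s Ts); lra. }
destruct Hr as [d1 [d10 H1]], Hl as [d2 [d20 H2]].
exists (Rmin d1 d2); split; [apply Rmin_pos; assumption|]; intros s ks Hs.
pose proof (Rmin_l d1 d2); pose proof (Rmin_r d1 d2).
pose proof (kappa_T s ks) as Ts.
destruct (Rtotal_order s t) as [st|[->|st]].
- rewrite Rabs_left1 in Hs by lra.
  pose proof (kernel_int_mono s t Ts kt ltac:(lra)).
  pose proof (H2 s Ts ltac:(lra)); rewrite Rabs_left1; lra.
- rewrite Rminus_diag, Rabs_R0; exact He.
- rewrite Rabs_pos_eq in Hs by lra.
  pose proof (kernel_int_mono t s Tt ks ltac:(lra)).
  pose proof (H1 s Ts ltac:(lra)); rewrite Rabs_pos_eq; lra.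
Qed.

Lemma kernel_int_rd : rd_continuous T (kappa T) (kernel_int g).
Proof.
apply rd_continuous_mono.
- intros s t ks kt st; apply kernel_int_mono; auto; apply kappa_T, ks.
- exact kernel_int_continuous.
Qed.

End Weight.

End Kernel.

Lemma kernel_int_dominated (k : R -> R -> R) (g h : R -> R) (c s : R) :
  kernel_cond T a k ->
  (forall t r, T t -> T r -> r <= t -> 0 <= k t r) ->
  rd_continuous T (kappa T) g -> rd_continuous T (kappa T) h ->
  (forall r, kappa T r -> g r <= c * h r) -> kappa T s ->
  kernel_int k g s <= c * kernel_int k h s.
Proof.
intros kc k0 Hg Hh gh ks; pose proof (kappa_T s ks) as Ts; unfold kernel_int.
rewrite <- delta_int_scal by (auto; apply kernel_weight_rd; assumption).
apply delta_int_le; auto; [apply kernel_weight_rd; assumption| |].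
- apply rd_continuous_mult; [|apply kernel_weight_rd; assumption].
  apply rd_continuous_continuous; intros; apply filterlim_within_const.
- intros r Tr rs; replace (c * (k s r * h r)) with (k s r * (c * h r)) by ring.
  apply Rmult_le_compat_l; [apply k0; auto; lra|].
  apply gh, kappa_le with s; auto; lra.
Qed.

Lemma kernel_int_plus (k : R -> R -> R) (g h : R -> R) (s : R) :
  kernel_cond T a k ->
  rd_continuous T (kappa T) g -> rd_continuous T (kappa T) h -> kappa T s ->
  kernel_int k (fun r => g r + h r) s = kernel_int k g s + kernel_int k h s.
Proof.
intros kc Hg Hh ks; pose proof (kappa_T s ks) as Ts; unfold kernel_int.
rewrite <- delta_int_plus by (auto; apply kernel_weight_rd; assumption).
f_equal; apply functional_extensionality; intros r; ring.
Qed.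

(** * The comparison function Psi *)

Lemma continuous_Rplus_comp (Phi W : R -> R) (x : R) :
  continuous_Rplus Phi -> continuous_Rplus W ->
  (forall y, 0 <= y -> 0 <= W y) -> 0 < x ->
  continuous (fun s => Phi (W s)) x.
Proof.
intros HPhi HW W0 x0.
pose proof (HW x ltac:(lra)) as Wx.
pose proof (HPhi (W x) ltac:(apply W0; lra)) as Px.
rewrite filterlim_withinP in Wx; rewrite filterlim_withinP in Px.
apply filterlim_locally; intros eps.
destruct (Px eps (cond_pos eps)) as [d1 [d10 H1]].
destruct (Wx d1 d10) as [d2 [d20 H2]].
apply locally_Rabs; exists (Rmin d2 x); split; [apply Rmin_pos; assumption|].
intros s Hs; pose proof (Rmin_l d2 x); pose proof (Rmin_r d2 x).
assert (s0 : 0 <= s).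
{ apply Rabs_lt_between in Hs; lra. }
apply (H1 (W s)); [apply W0, s0|apply H2; lra].
Qed.

Section Comparison.

Context (Phi W : R -> R) (x0 : R) (x0_pos : 0 < x0).
Context (comp_pos : forall x, 0 < x -> 0 < Phi (W x)).
Context (comp_cont : forall x, 0 < x -> continuous (fun s => Phi (W s)) x).
Context (comp_mono : forall x y, 0 <= x -> x <= y -> Phi (W x) <= Phi (W y)).

Lemma Psi_continuous_integrand (x : R) :
  0 < x -> continuous (fun s => / Phi (W s)) x.
Proof.
intros x_pos.
apply (continuous_comp (fun s => Phi (W s)) Rinv); [apply comp_cont, x_pos|].
apply continuous_Rinv; pose proof (comp_pos x x_pos); lra.
Qed.

Lemma Psi_ex_RInt (x y : R) : 0 < x -> 0 < y ->
  ex_RInt (fun s => / Phi (W s)) x y.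
Proof.
intros x_pos y_pos; apply (ex_RInt_continuous (V := R_CompleteNormedModule)).
intros z Hz; apply Psi_continuous_integrand.
apply Rlt_le_trans with (2 := proj1 Hz); apply Rmin_pos; assumption.
Qed.

Lemma Psi_derive (x : R) : 0 < x ->
  is_derive (Psi Phi W x0) x (/ Phi (W x)).
Proof.
intros x_pos; apply (is_derive_RInt (fun s => / Phi (W s)) _ x0).
- apply locally_Rabs; exists x; split; [exact x_pos|]; intros y Hy.
  apply (RInt_correct (fun s => / Phi (W s))), Psi_ex_RInt; [exact x0_pos|].
  apply Rabs_lt_between in Hy; lra.
- apply Psi_continuous_integrand, x_pos.
Qed.

Lemma Psi_increment (x y : R) : 0 < x -> x <= y ->
  (y - x) / Phi (W y) <= Psi Phi W x0 y - Psi Phi W x0 x <= (y - x) / Phi (W x).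
Proof.
intros x_pos xy.
assert (E : Psi Phi W x0 y - Psi Phi W x0 x = RInt (fun s => / Phi (W s)) x y).
{ unfold Psi; rewrite <- (RInt_Chasles (fun s => / Phi (W s)) x0 x y)
    by (apply Psi_ex_RInt; lra).
  unfold plus; simpl; ring. }
rewrite E.
assert (Hc : forall c, (y - x) / c = RInt (fun _ => / c) x y).
{ intros c; rewrite RInt_const; reflexivity. }
rewrite !Hc; split; apply RInt_le; auto;
  try apply ex_RInt_const; try (apply Psi_ex_RInt; lra);
  intros z Hz; apply Rinv_le_contravar;
  (apply comp_pos || apply comp_mono); lra.
Qed.

Lemma Psi_lt (x y : R) : 0 < x -> x < y -> Psi Phi W x0 x < Psi Phi W x0 y.
Proof.
intros x_pos xy; pose proof (Psi_increment x y x_pos ltac:(lra)) as [H _].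
assert (0 < (y - x) / Phi (W y)); [|lra].
apply Rdiv_lt_0_compat; [lra|apply comp_pos; lra].
Qed.

Lemma Psi_le_reg (x y : R) : 0 < x -> 0 < y ->
  Psi Phi W x0 x <= Psi Phi W x0 y -> x <= y.
Proof.
intros x_pos y_pos H; apply Rnot_lt_le; intros yx.
pose proof (Psi_lt y x y_pos yx); lra.
Qed.

Lemma Psi_inv_spec (y : R) : Dom_Psi_inv Phi W x0 y ->
  0 < Psi_inv Phi W x0 y /\ Psi Phi W x0 (Psi_inv Phi W x0 y) = y.
Proof. intros Hy; exact (epsilon_spec (inhabits 0) _ Hy). Qed.

Lemma Psi_inv_mono (y z : R) : Dom_Psi_inv Phi W x0 y ->
  Dom_Psi_inv Phi W x0 z -> y <= z -> Psi_inv Phi W x0 y <= Psi_inv Phi W x0 z.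
Proof.
intros Hy Hz yz.
destruct (Psi_inv_spec y Hy) as [y_pos Ey], (Psi_inv_spec z Hz) as [z_pos Ez].
apply Psi_le_reg; auto; lra.
Qed.

Lemma Dom_Psi_inv_interval (x y z : R) : 0 < x -> Psi Phi W x0 x <= y ->
  y <= z -> Dom_Psi_inv Phi W x0 z -> Dom_Psi_inv Phi W x0 y.
Proof.
intros x_pos [xy| <-] yz [v [v_pos Ev]]; [|exists x; auto].
destruct yz as [yz| ->]; [|exists v; auto].
destruct (IVT_interv (fun s => Psi Phi W x0 s - y) x v) as [w [Hw Ew]].
- intros s Hs; apply continuity_pt_minus; [|apply continuity_pt_const; easy].
  apply continuity_pt_filterlim.
  apply (ex_derive_continuous (V := R_NormedModule) (Psi Phi W x0)).
  exists (/ Phi (W s)); apply Psi_derive; lra.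
- apply Rnot_le_lt; intros vx; destruct vx as [vx| ->]; [|lra].
  pose proof (Psi_lt v x v_pos vx); lra.
- lra.
- lra.
- exists w; split; lra.
Qed.

Lemma Psi_inv_continuous (D : R -> Prop) (h : R -> R) (t : R) :
  (forall s, D s -> Dom_Psi_inv Phi W x0 (h s)) ->
  Dom_Psi_inv Phi W x0 (h t) ->
  filterlim h (within D (locally t)) (locally (h t)) ->
  filterlim (fun s => Psi_inv Phi W x0 (h s)) (within D (locally t))
    (locally (Psi_inv Phi W x0 (h t))).
Proof.
intros HD Ht Hh; rewrite filterlim_withinP in Hh.
destruct (Psi_inv_spec _ Ht) as [y_pos Ey]; set (y := Psi_inv Phi W x0 (h t)) in *.
apply filterlim_withinP; intros eps He.
set (e := Rmin (eps / 2) (y / 2)).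
assert (e0 : 0 < e) by (apply Rmin_pos; lra).
pose proof (Rmin_l (eps / 2) (y / 2) : e <= eps / 2).
pose proof (Rmin_r (eps / 2) (y / 2) : e <= y / 2).
pose proof (Psi_lt (y - e) y ltac:(lra) ltac:(lra)) as Hlow.
pose proof (Psi_lt y (y + e) ltac:(lra) ltac:(lra)) as Hup.
destruct (Hh (Rmin (Psi Phi W x0 y - Psi Phi W x0 (y - e))
                (Psi Phi W x0 (y + e) - Psi Phi W x0 y))) as [d [d0 Hd]].
{ apply Rmin_pos; lra. }
exists d; split; [exact d0|]; intros s Ds Hs; specialize (Hd s Ds Hs).
destruct (Psi_inv_spec _ (HD s Ds)) as [v_pos Ev].
set (v := Psi_inv Phi W x0 (h s)) in *.
pose proof (Rlt_le_trans _ _ _ Hd (Rmin_l _ _)) as H1.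
pose proof (Rlt_le_trans _ _ _ Hd (Rmin_r _ _)) as H2.
apply Rabs_lt_between in H1; apply Rabs_lt_between in H2.
assert (y - e <= v) by (apply Psi_le_reg; lra).
assert (v <= y + e) by (apply Psi_le_reg; lra).
apply Rle_lt_trans with e; [apply Rabs_le; lra|lra].
Qed.

(** Bihari's inequality.  Across a gap the mean value of the decreasing
    integrand of [Psi] is at most its value at the left end, so that [Psi]
    along the right-hand side grows no faster than the integral of [c]. *)
Lemma delta_bihari (c X : R -> R) (zeta t : R) : T t -> 0 < zeta ->
  rd_continuous T (ts_itv T a t) c ->
  rd_continuous T (ts_itv T a t) (fun s => c s * Phi (W (X s))) ->
  (forall s, T s -> s < t -> 0 <= c s) ->
  (forall s, T s -> s < t -> 0 <= X s) ->
  (forall s, T s -> s < t -> 0 <= Phi (W (X s))) ->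
  (forall s, T s -> s < t ->
     X s <= zeta + delta_int T (fun r => c r * Phi (W (X r))) a s) ->
  0 < zeta + delta_int T (fun r => c r * Phi (W (X r))) a t /\
  Psi Phi W x0 (zeta + delta_int T (fun r => c r * Phi (W (X r))) a t)
    <= Psi Phi W x0 zeta + delta_int T c a t.
Proof.
intros Tt zeta0 Hc HcX c0 X0 F0 HX; pose proof (T_bounds t Tt) as Ht.
destruct (delta_int_primitive _ t Tt HcX) as [G [HG EG]].
destruct (delta_int_primitive c t Tt Hc) as [C [HC EC]].
assert (Ga : G a = 0).
{ rewrite <- EG by (auto; lra); apply delta_int_point. }
assert (Ca : C a = 0).
{ rewrite <- EC by (auto; lra); apply delta_int_point. }
assert (G0 : forall s, T s -> s <= t -> 0 <= G s).
{ intros s Ts st; rewrite <- EG by auto; apply delta_int_nonneg; auto.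
  - apply rd_continuous_itv_le with t; assumption.
  - intros r Tr rs; apply Rmult_le_pos; [apply c0|apply F0]; auto; lra. }
rewrite EG, EC by (auto; lra).
split; [pose proof (G0 t Tt ltac:(lra)); lra|].
assert (main : C a - Psi Phi W x0 (zeta + G a) <= C t - Psi Phi W x0 (zeta + G t)).
{ apply (delta_derive_nonneg_incr (fun s => C s - Psi Phi W x0 (zeta + G s)));
    auto; [lra|].
  intros s ks Hs; pose proof (kappa_T s ks) as Ts.
  pose proof (G0 s Ts ltac:(lra)) as Gs0.
  set (F := c s * Phi (W (X s))).
  assert (HY : is_delta_derive T (fun r => zeta + G r) s F).
  { rewrite <- (Rplus_0_l F).
    apply (delta_derive_plus (fun _ => zeta) G);
      [exact (delta_derive_const zeta s ks)|apply HG; auto; lra]. }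
  pose proof (comp_pos (zeta + G s) ltac:(lra)) as w0.
  assert (HF : s < t -> F / Phi (W (zeta + G s)) <= c s).
  { intros st; apply Rmult_le_reg_r with (Phi (W (zeta + G s))); [exact w0|].
    unfold Rdiv; rewrite Rmult_assoc, Rinv_l, Rmult_1_r by lra; unfold F.
    apply Rmult_le_compat_l; [auto|]; apply comp_mono; [auto|].
    rewrite <- EG by (auto; lra); auto. }
  destruct (fjump_ge s Ts) as [sj|sj].
  - exists (c s - (Psi Phi W x0 (zeta + G (fjump T s))
      - Psi Phi W x0 (zeta + G s)) / (fjump T s - s)); split.
    + apply delta_derive_minus; [apply HC; auto; lra|].
      apply (delta_derive_scattered (fun r => Psi Phi W x0 (zeta + G r))); auto.
      apply (filterlim_within_comp T (Psi Phi W x0) (fun r => zeta + G r)).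
      * apply (ex_derive_continuous (V := R_NormedModule) (Psi Phi W x0)).
        exists (/ Phi (W (zeta + G s))); apply Psi_derive; lra.
      * exact (delta_derive_continuous _ _ _ HY).
    + intros st; specialize (HF st).
      pose proof (delta_derive_step _ s _ Ts HY) as Hstep; simpl in Hstep.
      assert (F0' : 0 <= F) by (apply Rmult_le_pos; auto).
      assert (Fmu : 0 <= F * (fjump T s - s)) by (apply Rmult_le_pos; lra).
      pose proof (Psi_increment (zeta + G s) (zeta + G (fjump T s)) ltac:(lra)
        ltac:(lra)) as [_ Hinc].
      rewrite Hstep in Hinc.
      enough ((Psi Phi W x0 (zeta + G (fjump T s)) - Psi Phi W x0 (zeta + G s))
        / (fjump T s - s) <= F / Phi (W (zeta + G s))) by lra.
      apply Rmult_le_reg_r with (fjump T s - s); [lra|].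
      unfold Rdiv at 1; rewrite Rmult_assoc, Rinv_l, Rmult_1_r by lra.
      apply Rle_trans with (1 := Hinc); right; field; lra.
  - exists (c s - / Phi (W (zeta + G s)) * F); split.
    + apply delta_derive_minus; [apply HC; auto; lra|].
      apply (delta_derive_comp_dense (Psi Phi W x0) (fun r => zeta + G r));
        [auto|exact HY|apply Psi_derive; lra].
    + intros st; specialize (HF st); unfold Rdiv in HF; lra. }
rewrite Ga, Ca, Rplus_0_r in main; lra.
Qed.

End Comparison.

(** * The estimate on a compact time scale *)

Section Estimate.

Context (u f alpha E w : R -> R) (k : R -> R -> R) (Phi W : R -> R) (x0 : R).
Context (u_nonneg : forall t, T t -> 0 <= u t) (u_rd : rd_continuous T T u).
Context (f_nonneg : forall t, kappa T t -> 0 <= f t).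
Context (f_rd : rd_continuous T (kappa T) f).
Context (k_cond : kernel_cond T a k).
Context (k_nonneg : forall t s, T t -> T s -> s <= t -> 0 <= k t s).
Context (k_derive_nonneg : forall t s, T t -> T s -> s <= t ->
  ex_delta_derive T (fun x => k x s) t ->
  0 <= delta_derive T (fun x => k x s) t).
Context (Phi_nonneg : forall x, 0 <= x -> 0 <= Phi x).
Context (Phi_cont : continuous_Rplus Phi).
Context (Phi_mono : nondecreasing_on (fun x => 0 <= x) Phi).
Context (Phi_add :
  forall x y, 0 <= x -> 0 <= y -> Phi (x + y) <= Phi x + Phi y).
Context (Phi_mul :
  forall x y, 0 <= x -> 0 <= y -> Phi (x * y) <= Phi x * Phi y).
Context (Phi_pos : forall x, 0 < x -> 0 < Phi x).
Context (W_nonneg : forall x, 0 <= x -> 0 <= W x).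
Context (W_cont : continuous_Rplus W).
Context (W_mono : nondecreasing_on (fun x => 0 <= x) W).
Context (W_pos : forall x, 0 < x -> 0 < W x).
Context (alpha_pos : forall t, T t -> 0 < alpha t).
Context (alpha_rd : rd_continuous T T alpha).
Context (alpha_mono : nondecreasing_on T alpha).
Context (x0_pos : 0 < x0).
Context (E_exp : exp_pair f E w).

(* [X] is the argument of [W] in the hypothesis on [u], [v] the last term of
   that hypothesis, and [H] the argument of the inverse of [Psi]; [base] and
   [m] are the weights in the bound of [Phi (u s)] in [Phi_u_le]. *)
Let X := kernel_int k (fun s => Phi (u s)).
Let v := fun t => delta_int T (fun s => f s * W (X s)) a t.
Let F := fun t => delta_int T f a t.
Let m := fun s => Phi (E s) * Phi (F s).
Let base := fun s => Phi (E s * alpha s).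
Let zeta := kernel_int k base (bjump T b).
Let H := fun t => Psi Phi W x0 zeta + kernel_int k m t.

Context (u_bound : forall t, T t ->
  u t <= alpha t + delta_int T (fun s => f s * u s) a t + v t).

Lemma kappa_bjump_max : kappa T (bjump T b).
Proof. apply kappaP; split; [apply T_bjump, Tb|lra]. Qed.

Lemma E_ge_1 (t : R) : T t -> 1 <= E t.
Proof.
intros Tt; rewrite <- (exp_pair_start _ _ _ E_exp).
apply exp_pair_incr with f w; auto; apply T_bounds, Tt.
Qed.

Lemma E_rd : rd_continuous T (kappa T) E.
Proof.
apply rd_continuous_derivable; intros t kt; exists (f t * E t).
apply exp_pair_derive with (1 := E_exp); exact kt.
Qed.

Lemma Phi_u_rd : rd_continuous T (kappa T) (fun s => Phi (u s)).
Proof.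
apply rd_continuous_comp; auto using rd_continuous_on_kappa.
intros s ks; apply u_nonneg, kappa_T, ks.
Qed.

Lemma X_nonneg (s : R) : kappa T s -> 0 <= X s.
Proof.
intros ks; apply kernel_int_nonneg; auto using Phi_u_rd.
intros r kr; apply Phi_nonneg, u_nonneg, kappa_T, kr.
Qed.

Lemma X_mono (s t : R) : T s -> kappa T t -> s <= t -> X s <= X t.
Proof.
intros Ts kt st; apply kernel_int_mono; auto using Phi_u_rd.
intros r kr; apply Phi_nonneg, u_nonneg, kappa_T, kr.
Qed.

Lemma X_rd : rd_continuous T (kappa T) X.
Proof.
apply kernel_int_rd; auto using Phi_u_rd.
intros r kr; apply Phi_nonneg, u_nonneg, kappa_T, kr.
Qed.

Lemma WX_rd : rd_continuous T (kappa T) (fun s => W (X s)).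
Proof. apply rd_continuous_comp; auto using X_nonneg, X_rd. Qed.

Lemma fWX_rd (d : R) :
  T d -> rd_continuous T (ts_itv T a d) (fun s => f s * W (X s)).
Proof.
intros Td; apply rd_continuous_kappa; [exact Td|].
apply rd_continuous_mult; [exact f_rd|exact WX_rd].
Qed.

Lemma fWX_nonneg (s : R) : kappa T s -> 0 <= f s * W (X s).
Proof. intros ks; apply Rmult_le_pos; auto using X_nonneg. Qed.

Lemma kappa_before (s t : R) : T s -> T t -> s < t -> kappa T s.
Proof.
intros Ts Tt st; apply kappa_lt; [exact Ts|pose proof (T_bounds t Tt); lra].
Qed.

Lemma v_incr (s t : R) : T s -> T t -> s <= t -> v s <= v t.
Proof.
intros Ts Tt st; apply delta_int_incr; auto using fWX_rd.
intros r Tr Hr; apply fWX_nonneg, kappa_before with t; auto; lra.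
Qed.

Lemma v_nonneg (t : R) : T t -> 0 <= v t.
Proof.
intros Tt; apply delta_int_nonneg; auto using fWX_rd.
intros r Tr Hr; apply fWX_nonneg, kappa_before with t; auto; lra.
Qed.

Lemma F_nonneg (t : R) : T t -> 0 <= F t.
Proof.
intros Tt; apply delta_int_nonneg; auto using rd_continuous_kappa.
intros r Tr Hr; apply f_nonneg, kappa_before with t; auto; lra.
Qed.

Lemma F_rd : rd_continuous T (kappa T) F.
Proof.
apply rd_continuous_subset with (ts_itv T a b).
- intros s ks; pose proof (kappa_T s ks) as Ts; split; [exact Ts|].
  apply T_bounds, Ts.
- apply rd_continuous_continuous, delta_int_continuous; [exact Tb|].
  apply rd_continuous_kappa; auto.
Qed.

Lemma m_rd : rd_continuous T (kappa T) m.
Proof.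
apply rd_continuous_mult; apply rd_continuous_comp; auto using E_rd, F_rd.
- intros s ks; pose proof (E_ge_1 s (kappa_T s ks)); lra.
- intros s ks; apply F_nonneg, kappa_T, ks.
Qed.

Lemma m_nonneg (s : R) : T s -> 0 <= m s.
Proof.
intros Ts; pose proof (E_ge_1 s Ts).
apply Rmult_le_pos; apply Phi_nonneg; [lra|apply F_nonneg, Ts].
Qed.

Lemma base_rd : rd_continuous T (kappa T) base.
Proof.
apply (rd_continuous_comp _ Phi (fun s => E s * alpha s)); auto.
- intros s ks; pose proof (kappa_T s ks) as Ts; pose proof (E_ge_1 s Ts).
  pose proof (alpha_pos s Ts); apply Rmult_le_pos; lra.
- apply rd_continuous_mult; auto using E_rd, rd_continuous_on_kappa.
Qed.

Lemma base_lower (s : R) : T s -> Phi (alpha a) <= base s.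
Proof.
intros Ts; pose proof (E_ge_1 s Ts); pose proof (alpha_pos a Ta).
assert (alpha a <= alpha s) by (apply alpha_mono; auto; apply T_bounds, Ts).
assert (1 * alpha s <= E s * alpha s) by (apply Rmult_le_compat_r; lra).
apply Phi_mono; lra.
Qed.

Lemma base_nonneg (s : R) : T s -> 0 <= base s.
Proof.
intros Ts; pose proof (base_lower s Ts); pose proof (Phi_pos _ (alpha_pos a Ta)).
lra.
Qed.

(** Gronwall's inequality with the nondecreasing [alpha + v] as a constant. *)
Lemma u_le_E (t : R) : T t -> u t <= E t * (alpha t + v t).
Proof.
intros Tt; apply Rle_trans with
  ((alpha t + v t) + delta_int T (fun s => f s * u s) a t);
  [pose proof (u_bound t Tt); lra|].
apply (delta_gronwall f E w); auto.
- apply rd_continuous_kappa; [exact Tt|].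
  apply rd_continuous_mult; auto using rd_continuous_on_kappa.
- intros s Ts st; pose proof (u_bound s Ts).
  pose proof (v_incr s t Ts Tt ltac:(lra)).
  assert (alpha s <= alpha t) by (apply alpha_mono; auto; lra).
  lra.
Qed.

(** [X] is nondecreasing, so that [W (X t)] can be taken out of the integral. *)
Lemma v_le_WXF (t : R) : kappa T t -> v t <= W (X t) * F t.
Proof.
intros kt; pose proof (kappa_T t kt) as Tt; unfold v, F.
rewrite <- delta_int_scal by auto using rd_continuous_kappa.
apply delta_int_le; auto using fWX_rd.
- apply rd_continuous_mult; [|apply rd_continuous_kappa; auto].
  apply rd_continuous_continuous; intros; apply filterlim_within_const.
- intros s Ts st; assert (ks : kappa T s) by (apply kappa_before with t; auto).
  rewrite (Rmult_comm (W (X t))); apply Rmult_le_compat_l; auto.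
  apply W_mono; auto using X_nonneg; apply X_mono; auto; lra.
Qed.

(** Subadditivity separates [alpha] from [v], and submultiplicativity isolates
    the factor [Phi (W (X s))] on which Bihari's inequality acts. *)
Lemma Phi_u_le (s : R) :
  kappa T s -> Phi (u s) <= base s + m s * Phi (W (X s)).
Proof.
intros ks; pose proof (kappa_T s ks) as Ts.
pose proof (E_ge_1 s Ts); pose proof (alpha_pos s Ts) as al0.
pose proof (v_nonneg s Ts) as v0; pose proof (F_nonneg s Ts) as F0.
pose proof (W_nonneg _ (X_nonneg s ks)) as WX0.
assert (A0 : 0 <= E s * alpha s) by (apply Rmult_le_pos; lra).
assert (B0 : 0 <= E s * v s) by (apply Rmult_le_pos; lra).
assert (Pv : Phi (v s) <= Phi (W (X s)) * Phi (F s)).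
{ apply Rle_trans with (Phi (W (X s) * F s)); [|auto].
  apply Phi_mono; auto using v_le_WXF; apply Rmult_le_pos; assumption. }
apply Rle_trans with (Phi (E s * alpha s + E s * v s)).
{ apply Phi_mono; auto; [lra|].
  rewrite <- Rmult_plus_distr_l; apply u_le_E, Ts. }
apply Rle_trans with (1 := Phi_add _ _ A0 B0).
apply Rplus_le_compat_l.
apply Rle_trans with (Phi (E s) * Phi (v s)); [apply Phi_mul; lra|].
unfold m; rewrite Rmult_assoc, (Rmult_comm (Phi (F s))).
apply Rmult_le_compat_l; [apply Phi_nonneg; lra|exact Pv].
Qed.

Lemma PhiWX_rd : rd_continuous T (kappa T) (fun s => m s * Phi (W (X s))).
Proof.
apply rd_continuous_mult; [exact m_rd|].
apply rd_continuous_comp; auto using WX_rd, X_nonneg.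
Qed.

Lemma PhiWX_nonneg (s : R) : kappa T s -> 0 <= m s * Phi (W (X s)).
Proof.
intros ks; apply Rmult_le_pos; [apply m_nonneg, kappa_T, ks|].
auto using X_nonneg.
Qed.

Lemma X_le_frozen (s t : R) : T s -> kappa T t -> s <= t ->
  X s <= zeta + delta_int T (fun r => k t r * m r * Phi (W (X r))) a s.
Proof.
intros Ts kt st; assert (ks : kappa T s) by (apply kappa_le with t; auto).
apply Rle_trans with (kernel_int k (fun r => base r + m r * Phi (W (X r))) s).
{ rewrite <- Rmult_1_l.
  apply kernel_int_dominated; auto using Phi_u_rd.
  - apply rd_continuous_plus; auto using base_rd, PhiWX_rd.
  - intros r kr; rewrite Rmult_1_l; apply Phi_u_le, kr. }
rewrite kernel_int_plus by auto using base_rd, PhiWX_rd.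
apply Rplus_le_compat.
- apply kernel_int_mono; auto using base_rd, kappa_bjump_max.
  + intros r kr; apply base_nonneg, kappa_T, kr.
  + apply kappaP; exact ks.
- replace (fun r => k t r * m r * Phi (W (X r)))
    with (fun r => k t r * (m r * Phi (W (X r))))
    by (apply functional_extensionality; intros r; ring).
  apply kernel_int_freeze; auto using PhiWX_rd, PhiWX_nonneg.
Qed.

Lemma zeta_nonneg : 0 <= zeta.
Proof.
apply kernel_int_nonneg; auto using base_rd, kappa_bjump_max.
intros r kr; apply base_nonneg, kappa_T, kr.
Qed.

(** [base] is bounded below by a positive constant and rd-continuous weights
    are bounded, so that [zeta] dominates every integral against the kernel. *)
Lemma kernel_int_zero (g : R -> R) (s : R) : zeta = 0 ->
  rd_continuous T (kappa T) g -> (forall r, kappa T r -> 0 <= g r) ->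
  kappa T s -> kernel_int k g s = 0.
Proof.
intros z0 Hg g0 ks.
apply Rle_antisym; [|apply kernel_int_nonneg; auto].
pose proof kappa_bjump_max as kj.
destruct (rd_continuous_bounded g (bjump T b)) as [M [M0 HM]];
  [apply kappa_T, kj|apply rd_continuous_kappa; [apply kappa_T, kj|exact Hg]|].
pose proof (Phi_pos _ (alpha_pos a Ta)) as P0.
apply Rle_trans with (kernel_int k g (bjump T b)).
{ apply kernel_int_mono; auto; [apply kappa_T, ks|apply kappaP; exact ks]. }
apply Rle_trans with (M / Phi (alpha a) * kernel_int k base (bjump T b));
  [|fold zeta; rewrite z0; lra].
apply kernel_int_dominated; auto using base_rd.
intros r kr; pose proof (proj1 (kappaP r) kr) as [Tr Hr].
apply Rle_trans with M.
- eapply Rle_trans; [apply Rle_abs|apply HM; auto].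
  split; [apply T_bounds, Tr|exact Hr].
- apply Rle_trans with (M / Phi (alpha a) * Phi (alpha a)).
  + right; field; lra.
  + apply Rmult_le_compat_l; [|apply base_lower, Tr].
    apply Rlt_le, Rdiv_lt_0_compat; assumption.
Qed.

Lemma PhiW_pos (x : R) : 0 < x -> 0 < Phi (W x).
Proof. auto. Qed.

Lemma PhiW_cont (x : R) : 0 < x -> continuous (fun s => Phi (W s)) x.
Proof. apply continuous_Rplus_comp; auto. Qed.

Lemma PhiW_mono (x y : R) : 0 <= x -> x <= y -> Phi (W x) <= Phi (W y).
Proof.
intros x_nonneg xy; apply Phi_mono; [apply W_nonneg; lra|apply W_nonneg; lra|].
apply W_mono; lra.
Qed.

Lemma H_mono (s t : R) : T s -> kappa T t -> s <= t -> H s <= H t.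
Proof.
intros Ts kt st; apply Rplus_le_compat_l, kernel_int_mono; auto using m_rd.
intros r kr; apply m_nonneg, kappa_T, kr.
Qed.

(** For [zeta > 0] this is Bihari's inequality with the kernel frozen at [s].
    For [zeta = 0] the number [Psi zeta] need not be a convergent integral, but
    then [X] vanishes and [H] is constant. *)
Lemma X_le_Psi_inv (s t : R) : T s -> kappa T t -> s <= t ->
  Dom_Psi_inv Phi W x0 (H t) ->
  Dom_Psi_inv Phi W x0 (H s) /\ X s <= Psi_inv Phi W x0 (H s).
Proof.
intros Ts kt st HD; assert (ks : kappa T s) by (apply kappa_le with t; auto).
assert (m0 : forall r, kappa T r -> 0 <= m r).
{ intros r kr; apply m_nonneg, kappa_T, kr. }
destruct zeta_nonneg as [z_pos|z0].
- assert (HDs : Dom_Psi_inv Phi W x0 (H s)).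
  { apply (Dom_Psi_inv_interval Phi W x0 x0_pos PhiW_pos PhiW_cont PhiW_mono
      zeta (H s) (H t)); auto using H_mono.
    pose proof (kernel_int_nonneg k k_cond k_nonneg m m_rd m0 s ks).
    unfold H; lra. }
  split; [exact HDs|].
  destruct (Psi_inv_spec Phi W x0 _ HDs) as [y_pos Ey].
  destruct (delta_bihari Phi W x0 x0_pos PhiW_pos PhiW_cont PhiW_mono
    (fun r => k s r * m r) X zeta s Ts z_pos) as [Y_pos HY].
  + apply kernel_weight_rd; auto using m_rd.
  + replace (fun r => k s r * m r * Phi (W (X r)))
      with (fun r => k s r * (m r * Phi (W (X r))))
      by (apply functional_extensionality; intros r; ring).
    apply kernel_weight_rd; auto using PhiWX_rd.
  + intros r Tr rs; apply Rmult_le_pos; [apply k_nonneg|apply m_nonneg];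
      auto; lra.
  + intros r Tr rs; apply X_nonneg, kappa_le with s; auto; lra.
  + intros r Tr rs; apply Phi_nonneg, W_nonneg, X_nonneg, kappa_le with s;
      auto; lra.
  + intros r Tr rs; apply X_le_frozen; auto; lra.
  + apply Rle_trans with (1 := X_le_frozen s s Ts ks ltac:(lra)).
    apply (Psi_le_reg Phi W x0 x0_pos PhiW_pos PhiW_cont PhiW_mono); auto.
    rewrite Ey; exact HY.
- assert (E0 : H s = H t).
  { unfold H; rewrite !kernel_int_zero; auto using m_rd. }
  rewrite E0; split; [exact HD|].
  assert (X s = 0) as ->.
  { apply kernel_int_zero; auto using Phi_u_rd.
    intros r kr; apply Phi_nonneg, u_nonneg, kappa_T, kr. }
  apply Rlt_le, Psi_inv_spec, HD.
Qed.

(** The integral in the conclusion exists: only points up to [bjump T t]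
    matter, and there [H] takes its values in the domain of [Psi_inv]. *)
Lemma fWPsi_inv_rd (t : R) : T t -> Dom_Psi_inv Phi W x0 (H (bjump T t)) ->
  rd_continuous T (ts_itv T a t) (fun s => f s * W (Psi_inv Phi W x0 (H s))).
Proof.
intros Tt HD; set (e := bjump T t) in *.
assert (ke : kappa T e).
{ apply kappaP; split; [apply T_bjump, Tt|].
  apply bjump_mono; auto; apply T_bounds, Tt. }
assert (HDs : forall s, ts_itv T a e s -> Dom_Psi_inv Phi W x0 (H s)).
{ intros s [Ts Hs]; apply X_le_Psi_inv with e; auto; apply Hs. }
assert (Hsub : forall s, ts_itv T a e s -> kappa T s).
{ intros s [Ts Hs]; apply kappa_le with e; auto; apply Hs. }
apply rd_continuous_extend; [exact Tt|]; fold e.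
apply rd_continuous_mult; [apply rd_continuous_kappa; auto; apply kappa_T, ke|].
apply rd_continuous_comp; auto.
- intros s Ds; apply Rlt_le, Psi_inv_spec, HDs, Ds.
- apply rd_continuous_mono.
  + intros r s Dr Ds rs.
    apply (Psi_inv_mono Phi W x0 x0_pos PhiW_pos PhiW_cont PhiW_mono); auto.
    apply H_mono; [apply Dr|apply Hsub, Ds|exact rs].
  + intros s Ds Hsj.
    apply (Psi_inv_continuous Phi W x0 x0_pos PhiW_pos PhiW_cont PhiW_mono);
      auto.
    apply filterlim_within_plus; [apply filterlim_within_const|].
    apply filterlim_within_subset with (kappa T); [exact Hsub|].
    apply kernel_int_continuous; auto using m_rd.
    intros r kr; apply m_nonneg, kappa_T, kr.
Qed.

(** The estimate with [p] already identified as the exponential function. *)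
Lemma compact_scale_estimate (t : R) : T t ->
  Dom_Psi_inv Phi W x0 (H (bjump T t)) ->
  u t <= E t * alpha t
         + E t * delta_int T (fun s => f s * W (Psi_inv Phi W x0 (H s))) a t.
Proof.
intros Tt HD; apply Rle_trans with (1 := u_le_E t Tt).
rewrite Rmult_plus_distr_l; apply Rplus_le_compat_l, Rmult_le_compat_l;
  [pose proof (E_ge_1 t Tt); lra|].
assert (ke : kappa T (bjump T t)).
{ apply kappaP; split; [apply T_bjump, Tt|].
  apply bjump_mono; auto; apply T_bounds, Tt. }
apply delta_int_le; auto using fWX_rd, fWPsi_inv_rd.
intros s Ts st; assert (ks : kappa T s) by (apply kappa_before with t; auto).
destruct (X_le_Psi_inv s (bjump T t)) as [HDs HX]; auto.
{ apply bjump_ge; auto. }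
apply Rmult_le_compat_l; auto; apply W_mono; auto using X_nonneg.
apply Rlt_le, Psi_inv_spec, HDs.
Qed.

End Estimate.

End Scale.

Lemma closed_ts_itv (T : R -> Prop) (a b : R) :
  closed T -> closed (ts_itv T a b).
Proof.
intros HT x Hx.
assert (Hx' : forall P : R -> Prop, (exists d, 0 < d /\
  forall s, Rabs (s - x) < d -> P s) -> (forall s, P s -> ~ ts_itv T a b s) ->
  False).
{ intros P HP HPT; apply Hx; apply locally_Rabs in HP.
  revert HP; apply filter_imp; exact HPT. }
split; [|split].
- apply HT; intros HTx; apply (Hx' (fun s => ~ T s)).
  + apply locally_Rabs; exact HTx.
  + intros s Hs [Ts _]; contradiction.
- apply Rnot_lt_le; intros xa; apply (Hx' (fun s => s < a)).
  + exists (a - x); split; [lra|]; intros s Hs; apply Rabs_lt_between in Hs; lra.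
  + intros s Hs [_ Hs']; lra.
- apply Rnot_lt_le; intros xb; apply (Hx' (fun s => b < s)).
  + exists (x - b); split; [lra|]; intros s Hs; apply Rabs_lt_between in Hs; lra.
  + intros s Hs [_ Hs']; lra.
Qed.

Theorem theorem89 :
  forall (T : R -> Prop) (a b : R), time_scale T -> T a -> T b ->
  let Ts := ts_itv T a b in
  forall (u f : R -> R) (k : R -> R -> R) (Phi W alpha : R -> R) (x0 : R),
  (forall t, Ts t -> 0 <= u t) ->
  rd_continuous Ts Ts u ->
  (forall t, kappa Ts t -> 0 <= f t) ->
  rd_continuous Ts (kappa Ts) f ->
  kernel_cond Ts a k ->
  (forall t s, Ts t -> Ts s -> s <= t -> 0 <= k t s) ->
  (forall t s, Ts t -> Ts s -> s <= t ->
     ex_delta_derive Ts (fun x => k x s) t ->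
     0 <= delta_derive Ts (fun x => k x s) t) ->
  (exists t s, kappa Ts t /\ kappa (kappa Ts) s /\ k t s <> 0) ->
  (forall x, 0 <= x -> 0 <= Phi x) ->
  continuous_Rplus Phi ->
  nondecreasing_on (fun x => 0 <= x) Phi ->
  (forall x y, 0 <= x -> 0 <= y -> Phi (x + y) <= Phi x + Phi y) ->
  (forall x y, 0 <= x -> 0 <= y -> Phi (x * y) <= Phi x * Phi y) ->
  (forall x, 0 < x -> 0 < Phi x) ->
  (forall x, 0 <= x -> 0 <= W x) ->
  continuous_Rplus W ->
  nondecreasing_on (fun x => 0 <= x) W ->
  (forall x, 0 < x -> 0 < W x) ->
  (forall t, Ts t -> 0 < alpha t) ->
  rd_continuous Ts Ts alpha ->
  nondecreasing_on Ts alpha ->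
  0 < x0 ->
  (forall t, Ts t ->
     u t <= alpha t + delta_int Ts (fun s => f s * u s) a t
            + delta_int Ts (fun s =>
                f s * W (delta_int Ts (fun tau => k s tau * Phi (u tau)) a s))
                a t) ->
  let p := fun t =>
    1 + delta_int Ts (fun s => f s * delta_exp Ts f t (fjump Ts s)) a t in
  let zeta :=
    delta_int Ts (fun s => k (bjump Ts b) s * Phi (p s * alpha s))
      a (bjump Ts b) in
  let H := fun t =>
    Psi Phi W x0 zeta
    + delta_int Ts (fun s =>
        k t s * Phi (p s) * Phi (delta_int Ts f a s)) a t in
  forall t, Ts t ->
  Dom_Psi_inv Phi W x0 (H (bjump Ts t)) ->
  u t <= p t * alpha t
         + p t * delta_int Ts (fun s => f s * W (Psi_inv Phi W x0 (H s))) a t.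
Proof.
intros T a b [_ HT] Ta Tb Ts u f k Phi W alpha x0 u0 Hu f0 Hf Hk k0 k1 _
  Phi0 HPhi Phim Phia Phimul Phip W0 HW Wm Wp al0 Hal alm x0p Hbound
  p zeta H t Tst HD.
assert (Tsa : Ts a) by (destruct Tst as [_ Hab]; split; [exact Ta|lra]).
assert (Tsb : Ts b) by (destruct Tst as [_ Hab]; split; [exact Tb|lra]).
assert (Tsc : closed Ts) by (apply closed_ts_itv, HT).
assert (Tsab : forall s, Ts s -> a <= s <= b) by (intros s [_ Hs]; exact Hs).
destruct (exp_pair_exists Ts a b Tsc Tsa Tsb Tsab f f0 Hf) as [E [w HE]].
assert (pE : forall s, Ts s -> p s = E s).
{ intros s Tss; apply (delta_int_exp Ts a b Tsc Tsa Tsb Tsab f E w s HE Tss). }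
assert (Ez : zeta = kernel_int Ts a k (fun s => Phi (E s * alpha s))
  (bjump Ts b)).
{ apply delta_int_ext; intros s Tss; rewrite (pE s Tss); reflexivity. }
assert (EH : H = fun s => Psi Phi W x0 (kernel_int Ts a k
  (fun r => Phi (E r * alpha r)) (bjump Ts b))
  + kernel_int Ts a k (fun r => Phi (E r) * Phi (delta_int Ts f a r)) s).
{ apply functional_extensionality; intros s; unfold H; rewrite Ez; f_equal.
  apply delta_int_ext; intros r Tsr; rewrite (pE r Tsr); ring. }
rewrite (pE t Tst); rewrite EH in HD |- *.
apply (compact_scale_estimate Ts a b Tsc Tsa Tsb Tsab u f alpha E w); auto.
Qed.
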